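(* Let $\Gamma$ be a connected finite graph. The inclusion $\check L\mathcal M_\Gamma\subset L\mathcal M_\Gamma$ of the space of intrinsically robust loops is generic, i.e. $\check L\mathcal M_\Gamma$ is open and dense in $L\mathcal M_\Gamma$. In particular, every smooth loop $\gamma\in L\mathcal M_\Gamma$ can be perturbed by an arbitrarily small amount to an intrinsically robust smooth loop $\gamma_1\in\check L\mathcal M_\Gamma$.
   Context: Graph. $\Gamma=(\Gamma_0,\Gamma_1)$ is a connected finite graph with vertex set $\Gamma_0$ and edge set $\Gamma_1$ (multiple edges and loop edges allowed). Fix a total ordering of $\Gamma_0$; the face maps $d_0,d_1:\Gamma_1\to\Gamma_0$ give the endpoints of an edge, with $d_0(\alpha)\le d_1(\alpha)$ and equality iff $\alpha$ is a loop edge. $C_i(\Gamma;\mathbb R)$ ($i=0,1$) is the real vector space with basis $\Gamma_i$; $\partial:C_1(\Gamma;\mathbb R)\to C_0(\Gamma;\mathbb R)$ is $\partial\alpha=d_0(\alpha)-d_1(\alpha)$ and $\partial^*$ is its adjoint for the standard inner products. $H_1(\Gamma;\mathbb R)=\ker\partial$. $\bar C_0(\Gamma;\mathbb R)$ (resp. $\tilde C_0(\Gamma;\mathbb R)$) is the set of $\mathbf p\in C_0(\Gamma;\mathbb R)$ with $\sum_i\mathbf p_i=1$ (resp. $=0$). Parameters. $\mathcal M_\Gamma$ is the real vector space of pairs $(E,W)$ of functions $E:\Gamma_0\to\mathbb R$, $W:\Gamma_1\to\mathbb R$. $L\mathcal M_\Gamma$ is the space of smooth unbased loops $\gamma$ in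 $\mathcal M_\Gamma$ (smooth 1-periodic maps, parametrized by $[0,1]$) with the Whitney $C^\infty$ topology. Current. For $\beta>0$ and $(E,W)\in\mathcal M_\Gamma$ let $\hat g$ be the diagonal operator on $C_1(\Gamma;\mathbb R)$ with entries $e^{\beta W_\alpha}$, $\hat\kappa$ the diagonal operator on $C_0(\Gamma;\mathbb R)$ with entries $e^{\beta E_i}$, and $H=-\partial\hat g^{-1}\partial^*\hat\kappa$ the master operator. For $\gamma\in L\mathcal M_\Gamma$ and $\tau_D>0$ sufficiently large, the master equation $\dot{\mathbf p}(t)=\tau_DH(\gamma(t))\mathbf p(t)$, $t\in[0,1]$, has a unique solution $\rho$ in $\bar C_0(\Gamma;\mathbb R)$ with $\rho(0)=\rho(1)$. Put $\mathbf J(t)=\tau_D\hat g^{-1}\partial^*\hat\kappa\rho(t)$, $Q(\beta,\tau_D,\gamma)=\int_0^1\mathbf J(t)\,dt$, and $Q_\beta(\gamma)=\lim_{\tau_D\to\infty}Q(\beta,\tau_D,\gamma)\in H_1(\Gamma;\mathbb R)$. Equivalently $Q_\beta(\gamma)=\int_0^1A(\gamma(t),\tfrac{d}{dt}\rho^B(\gamma(t)))\,dt$, where $\rho^B(E,W)=\left(\sum_je^{-\beta E_j}\right)^{-1}\sum_je^{-\beta E_j}j$ and $A(E,W):\tilde C_0(\Gamma;\mathbb R)\to C_1(\Gamma;\mathbb R)$ is the inverse of the isomorphism $-\partial:\mathrm{im}(\hat g^{-1}\partial^* )\to\tilde C_0(\Gamma;\mathbb R)$ followed by inclusion. Robust loops.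 $\gamma\in L\mathcal M_\Gamma$ is intrinsically robust if there is an open neighborhood $U$ of $\gamma$ in $L\mathcal M_\Gamma$ such that $Q:=\lim_{\beta\to\infty}Q_\beta$ is well-defined and constant on $U$. $\check L\mathcal M_\Gamma$ is the subspace of intrinsically robust loops. *)

(* Defs.v *)
From HB Require Import structures.
From mathcomp Require Import all_boot all_order all_algebra.
From mathcomp Require Import all_classical all_reals all_analysis.

Set Implicit Arguments.
Unset Strict Implicit.
Unset Printing Implicit Defensive.

Import Order.TTheory GRing.Theory Num.Theory.
Import numFieldNormedType.Exports.

Local Open Scope classical_set_scope.
Local Open Scope ring_scope.

(* A finite graph with vertices 'I_(nvertices G), totally ordered as ordinals,
   and edges 'I_(nedges G). Multiple edges are allowed; a is a loop edge iff
   d0 a = d1 a. *)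
Record graph := Graph {
  nvertices : nat;
  nedges : nat;
  d0 : 'I_nedges -> 'I_nvertices;
  d1 : 'I_nedges -> 'I_nvertices;
  d0_le_d1 : forall a, (d0 a <= d1 a)%N
}.

Definition adjacent (G : graph) : rel 'I_(nvertices G) := fun i j =>
  [exists a : 'I_(nedges G),
    ((d0 a == i) && (d1 a == j)) || ((d0 a == j) && (d1 a == i))].

Definition connected_graph (G : graph) : Prop :=
  (0 < nvertices G)%N /\ forall i j, fingraph.connect (@adjacent G) i j.

(* Chains are column vectors, in the bases of vertices and edges; a point (E, W)
   of the parameter space is a pair of row vectors. *)
Notation C0 R G := 'cV[R]_(nvertices G).
Notation C1 R G := 'cV[R]_(nedges G).
Notation params R G := ('rV[R]_(nvertices G) * 'rV[R]_(nedges G))%type.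

Section operators.
Variables (R : realType) (G : graph).

Definition boundary : 'M[R]_(nvertices G, nedges G) :=
  \matrix_(i, a) ((d0 a == i)%:R - (d1 a == i)%:R).

Definition ghat (b : R) (x : params R G) : 'M[R]_(nedges G) :=
  diag_mx (\row_a expR (b * x.2 0 a)).

Definition kappahat (b : R) (x : params R G) : 'M[R]_(nvertices G) :=
  diag_mx (\row_i expR (b * x.1 0 i)).

(* The adjoint of the boundary for the standard inner products is its
   transpose. *)
Definition flux (b : R) (x : params R G) : 'M[R]_(nedges G, nvertices G) :=
  invmx (ghat b x) *m boundary^T *m kappahat b x.

Definition master (b : R) (x : params R G) : 'M[R]_(nvertices G) :=
  - (boundary *m flux b x).

Definition barC0 : set (C0 R G) := [set p | \sum_i p i 0 = 1].

End operators.

Section loops.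
Variables (R : realType) (G : graph).

Record loop := Loop {
  loop_fun :> R -> params R G;
  loop_smooth : forall (k : nat) (t : R), derivable (derive1n k loop_fun) t 1;
  loop_periodic : forall t : R, loop_fun (t + 1) = loop_fun t
}.

(* Derivatives up to order k uniformly e-close, for the sup norm on params. *)
Definition Ck_ball (g : loop) (k : nat) (e : R) : set loop :=
  [set h | forall j : nat, (j <= k)%N -> forall t : R, t \in `[0, 1] ->
     `|derive1n j g t - derive1n j h t| < e].

(* As the circle is compact, the sets Ck_ball g k e (all k and e > 0) form a
   neighbourhood basis at g for the Whitney C^oo topology. *)
Definition whitney_nbhs (g : loop) : set_system loop :=
  [set A | exists k : nat, exists2 e : R, 0 < e & Ck_ball g k e `<=` A].

Lemma Ck_ball_center (g : loop) k (e : R) : 0 < e -> Ck_ball g k e g.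
Proof. by move=> e0 j jk t t01; rewrite subrr normr0. Qed.

Lemma Ck_ball_trans (g h : loop) k (e : R) :
  Ck_ball g k (e / 2) h -> Ck_ball h k (e / 2) `<=` Ck_ball g k e.
Proof.
move=> gh f hf j jk t t01; rewrite -(subrKA (derive1n j h t)) [e]splitr.
by rewrite (le_lt_trans (ler_normD _ _))// ltrD ?gh ?hf.
Qed.

Lemma Ck_ball_sub (g : loop) k l (e e' : R) :
  (k <= l)%N -> e' <= e -> Ck_ball g l e' `<=` Ck_ball g k e.
Proof.
by move=> kl ee' h gh j jk t t01; rewrite (lt_le_trans _ ee')// gh// (leq_trans jk).
Qed.

Lemma whitney_nbhs_filter (g : loop) : ProperFilter (whitney_nbhs g).
Proof.
split.
  by move=> [k [e e0]] /(_ g); apply; exact: Ck_ball_center.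
split.
- by exists 0%N, 1.
- move=> A B [k [e e0 kA]] [l [d d0 lB]].
  exists (maxn k l), (Num.min e d); first by rewrite lt_min e0.
  move=> h gh; split.
    by apply: kA; apply: Ck_ball_sub gh; rewrite ?leq_maxl// ge_min lexx.
  by apply: lB; apply: Ck_ball_sub gh; rewrite ?leq_maxr// ge_min lexx orbT.
- by move=> A B AB [k [e e0 kA]]; exists k, e => // h /kA/AB.
Qed.

Lemma whitney_nbhs_singleton (g : loop) (A : set loop) :
  whitney_nbhs g A -> A g.
Proof. by move=> [k [e e0]]; apply; exact: Ck_ball_center. Qed.

Lemma whitney_nbhs_nbhs (g : loop) (A : set loop) :
  whitney_nbhs g A -> whitney_nbhs g (whitney_nbhs^~ A).
Proof.
move=> [k [e e0 kA]]; exists k, (e / 2); first by rewrite divr_gt0.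
move=> h gh; exists k, (e / 2); first by rewrite divr_gt0.
by move=> f /(Ck_ball_trans gh)/kA.
Qed.

HB.instance Definition _ := gen_eqMixin loop.
HB.instance Definition _ := gen_choiceMixin loop.
HB.instance Definition _ := hasNbhs.Build loop whitney_nbhs.
HB.instance Definition _ := Nbhs_isNbhsTopological.Build loop
  whitney_nbhs_filter whitney_nbhs_singleton whitney_nbhs_nbhs.

End loops.

Section current.
Variables (R : realType) (G : graph).

(* A solution on [0, 1], one-sided at the endpoints, extends differentiably to
   R (affinely outside [0, 1]), so two-sided derivatives lose nothing; only the
   values on [0, 1] are meaningful. *)
Definition periodic_solution (b tau : R) (g : loop R G) (rho : R -> C0 R G) :=
  [/\ forall t : R, t \in `[0, 1] -> barC0 (rho t),
      forall t : R, t \in `[0, 1] ->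
        is_derive t 1 rho (tau *: (master b (g t) *m rho t))
    & rho 0 = rho 1].

Definition unique_periodic_solution (b tau : R) (g : loop R G)
    (rho : R -> C0 R G) :=
  periodic_solution b tau g rho /\
  forall rho', periodic_solution b tau g rho' ->
    forall t : R, t \in `[0, 1] -> rho' t = rho t.

Definition current (b tau : R) (g : loop R G) (rho : R -> C0 R G) (t : R) :
    C1 R G :=
  tau *: (flux b (g t) *m rho t).

Definition integrated_current (b tau : R) (g : loop R G)
    (rho : R -> C0 R G) : C1 R G :=
  \col_a (\int[lebesgue_measure]_(t in `[0, 1]) (current b tau g rho t a 0)).

(* Q(b, tau, g) is defined and equal to q. *)
Definition is_average_current (b tau : R) (g : loop R G) (q : C1 R G) :=
  exists2 rho, unique_periodic_solution b tau g rho &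
    q = integrated_current b tau g rho.

(* Q(b, tau, g) is defined for tau large and Q_b(g) = q. *)
Definition is_adiabatic_current (b : R) (g : loop R G) (q : C1 R G) :=
  exists2 Q : R -> C1 R G,
    \forall tau \near +oo, is_average_current b tau g (Q tau) &
    Q tau @[tau --> +oo] --> q.

(* The limit of Q_b(g) as b --> +oo is defined and equal to q. *)
Definition is_limit_current (g : loop R G) (q : C1 R G) :=
  exists2 Q : R -> C1 R G,
    forall b : R, 0 < b -> is_adiabatic_current b g (Q b) &
    Q b @[b --> +oo] --> q.

Definition intrinsically_robust : set (loop R G) :=
  [set g | exists2 U : set (loop R G), open_nbhs g U &
     exists q : C1 R G, forall h, U h -> is_limit_current h q].

End current.

(* Main.v *)
From mathcomp Require Import all_boot all_order all_algebra.
From mathcomp Require Import all_classical all_reals normedtype.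
Import numFieldNormedType.Exports.
From mathcomp Require Import all_analysis.
From mathcomp Require Import ring lra zify.
Require Import Defs.
Import Order.TTheory GRing.Theory Num.Theory.
Import numFieldNormedType.Exports.
Local Open Scope classical_set_scope.
Local Open Scope ring_scope.
Set Implicit Arguments.
Unset Strict Implicit.
Unset Printing Implicit Defensive.

(** Openness holds by definition. For density, a loop is approximated by a
    generic one: a loop at each time of which the energies are pairwise distinct
    or the barriers are pairwise distinct. The complementary set of parameters
    has codimension two, so that a small translation makes a loop generic
    ([generic_perturbation]); instead of measure theory, a pigeonhole argument
    on a grid shows that finitely many curves do not fill a square
    ([curves_avoid_point]). It remains to see that generic loops are robust
    ([generic_loop_robust]), that is, to compute two limits.

    The adiabatic limit exists for every loop ([adiabatic_limit]). The master
    equation dissipates energy at a rate proportional to [tau], uniformly along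
    the loop, so that a periodic forcing of order one causes a response of order
    [1 / tau] ([periodic_decay]). This gives uniqueness of the periodic solution,
    its existence as a fixed vector of the monodromy matrix
    ([ex_periodic_solution]), and its convergence to the Boltzmann distribution.
    The current is [response] applied to the time derivative of the solution, and
    integration by parts identifies the limit with the integral of
    [response] applied to the derivative of the Boltzmann distribution.

    In the low temperature limit, two facts about the response matter. It is
    bounded by the total source, uniformly in all parameters ([le_response]); and
    if the barriers are distinct, it converges exponentially fast to the response
    along the minimal spanning tree, which only depends on the order of the
    barriers ([ex_tree_response]). Hence, while the ground state is unique, no
    current flows, the distribution being concentrated on the ground state; and
    while the barriers are distinct, the current is the image by a fixed matrix
    of the increment of the Boltzmann distribution. In both cases the current
    transported during a short time interval is, up to a telescoping term,
    asymptotically a constant that is shared by all neighbouring loops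
    ([settles]). By compactness the same holds for the whole loop, where the
    telescoping term vanishes. *)

(** * Calculus on the real line *)

Section calculus.
Variable R : realType.
Implicit Types f F : R -> R.

Lemma ler_sum_ord k (F : 'I_k -> R) (u : R) : (forall i, F i <= u) ->
  \sum_i F i <= k%:R * u.
Proof.
move=> Fu; rewrite mulr_natl -[k in leRHS]card_ord -sumr_const.
exact: ler_sum.
Qed.

Lemma close_between (t0 d s t u : R) : s \in `[0, 1] -> t \in `[0, 1] ->
  `|s - t0| < d -> `|t - t0| < d -> s <= u <= t ->
  u \in `[0, 1] /\ `|u - t0| < d.
Proof.
rewrite !in_itv/= !ltr_norml => /andP[s0 s1] /andP[u0 u1] /andP[s2 s3].
by move=> /andP[t2 t3] /andP[su ut]; split; apply/andP; split; lra.
Qed.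

Lemma unit_itv_length (s t : R) : s \in `[0, 1] -> t \in `[0, 1] -> t - s <= 1.
Proof. by rewrite !in_itv/= => /andP[s0 s1] /andP[t0 t1]; lra. Qed.

Lemma near_dist (t e : R) : 0 < e -> \forall s \near t, `|s - t| < e.
Proof. by move=> e0; exists e => //= s; rewrite /= distrC. Qed.

Lemma continuous_epsP f : continuous f <->
  forall t e : R, 0 < e -> exists2 d : R, 0 < d &
    forall s, `|s - t| < d -> `|f s - f t| < e.
Proof.
split=> [cf t e e0|fE t].
  have /nbhs_ballP[d d0 dP] : \forall s \near t, `|f t - f s| < e.
    exact: (cvgrPdist_lt _ _).1 (cf t) _ e0.
  by exists d => // s st; rewrite distrC; apply: dP; rewrite /ball/= distrC.
apply: (cvgrPdist_lt _ _).2 => e /(fE t)[d d0 dP].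
apply/nbhs_ballP; exists d => // s; rewrite /ball/= distrC => /dP.
by rewrite distrC.
Qed.

Lemma is_derive1_continuous f (t d : R) :
  is_derive t 1 f d -> {for t, continuous f}.
Proof. by case=> df _; exact/differentiable_continuous/derivable1_diffP. Qed.

Lemma is_derive_continuous_within f df (a b : R) :
  (forall t, t \in `[a, b] -> is_derive t 1 f (df t)) ->
  {within `[a, b], continuous f}.
Proof. by move=> fd; apply: derivable_within_continuous => t /fd[]. Qed.

Lemma is_derive_bigsum (I : Type) (r : seq I) (P : pred I) (h : I -> R -> R)
    (dh : I -> R) (t : R) :
  (forall i, P i -> is_derive t 1 (h i) (dh i)) ->
  is_derive t 1 (fun s => \sum_(i <- r | P i) h i s) (\sum_(i <- r | P i) dh i).
Proof.
move=> hd; elim: r => [|i r IH].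
  have -> : (fun s => \sum_(i <- [::] | P i) h i s) = cst 0.
    by apply/funext => s; rewrite big_nil.
  by rewrite big_nil; exact: is_derive_cst.
have -> : (fun s => \sum_(j <- i :: r | P j) h j s) =
    fun s => (if P i then h i s else 0) + \sum_(j <- r | P j) h j s.
  by apply/funext => s; rewrite big_cons; case: (P i) => //; rewrite add0r.
rewrite big_cons; case: (boolP (P i)) => Pi.
  by have := hd i Pi => hi; exact: is_deriveD.
have -> // : (fun s => 0 + \sum_(j <- r | P j) h j s) =
    (fun s => \sum_(j <- r | P j) h j s).
by apply/funext => s; rewrite add0r.
Qed.

Lemma continuous_bigsum (I : Type) (r : seq I) (P : pred I) (h : I -> R -> R) :
  (forall i, continuous (h i)) ->
  continuous (fun t => \sum_(i <- r | P i) h i t).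
Proof.
move=> hc t; elim: r => [|i r IH].
  by rewrite [X in continuous_at _ X](_ : _ = cst 0) ?funeqE => [|s];
    [exact: cvg_cst|rewrite big_nil].
rewrite [X in continuous_at _ X](_ : _ = (fun s =>
    (if P i then h i s else 0) + \sum_(j <- r | P j) h j s)); last first.
  by apply/funext => s; rewrite big_cons; case: (P i) => //; rewrite add0r.
by apply: cvgD => //; case: (P i); [exact: hc|exact: cvg_cst].
Qed.

Lemma continuous_mulr (f g : R -> R) : continuous f -> continuous g ->
  continuous (fun t => f t * g t).
Proof. by move=> fc gc t; apply: cvgM; [exact: fc|exact: gc]. Qed.

Lemma continuous_mulmx m n p (A : R -> 'M[R]_(m, n)) (B : R -> 'M[R]_(n, p)) :
  (forall i j, continuous (fun t => A t i j)) ->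
  (forall i j, continuous (fun t => B t i j)) ->
  forall i j, continuous (fun t => (A t *m B t) i j).
Proof.
move=> Ac Bc i j; under eq_fun do rewrite mxE.
by apply: continuous_bigsum => k; exact: continuous_mulr.
Qed.

Lemma mean_value F f (a b : R) : a <= b ->
  (forall t, t \in `[a, b] -> is_derive t 1 F (f t)) ->
  exists2 c, c \in `[a, b] & F b - F a = f c * (b - a).
Proof.
move=> ab Fd; have cF := is_derive_continuous_within Fd.
have Fd' t : t \in `]a, b[ -> is_derive t 1 F (f t).
  by move=> /subset_itv_oo_cc; exact: Fd.
exact: MVT_segment ab Fd' cF.
Qed.

Lemma le_increment F f (a b c : R) : a <= b ->
  (forall t, t \in `[a, b] -> is_derive t 1 F (f t)) ->
  (forall t, t \in `[a, b] -> `|f t| <= c) ->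
  `|F b - F a| <= c * (b - a).
Proof.
move=> ab Fd fc; have [t tab ->] := mean_value ab Fd.
by rewrite normrM (ger0_norm (_ : 0 <= b - a)) ?subr_ge0// ler_wpM2r ?subr_ge0// fc.
Qed.

Lemma integral_derivative F f (a b : R) : a < b ->
  (forall t, t \in `[a, b] -> is_derive t 1 F (f t)) ->
  {within `[a, b], continuous f} ->
  \int[lebesgue_measure]_(t in `[a, b]) f t = F b - F a.
Proof.
move=> ab Fd cf; rewrite /Rintegral (@continuous_FTC2 _ f F)//.
- have cF := is_derive_continuous_within Fd.
  have [_ Fa Fb] := (continuous_within_itvP F ab).1 cF.
  by split => // t /subset_itv_oo_cc/Fd[].
- by move=> t /subset_itv_oo_cc/Fd[_ <-]; rewrite derive1E.
Qed.

Lemma ge0_derive_left_max (F : R -> R) (a c d : R) : a < c ->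
  is_derive c 1 F d -> (forall s, a <= s <= c -> F s <= F c) -> 0 <= d.
Proof.
move=> ac [Fc Fd] Fmax; rewrite leNgt; apply/negP => d0.
have cv : (fun h : R => h^-1 *: (F (h *: 1 + c) - F c)) @ 0^' --> d.
  by rewrite -Fd; exact: Fc.
have nd : 0 < - d by rewrite oppr_gt0.
have [e /= e0 eP] := (cvgrPdist_lt _ _).1 cv _ nd.
pose h := - Num.min (e / 2) (c - a).
have e20 : 0 < e / 2 by lra.
have h0 : h < 0 by rewrite oppr_lt0 lt_min e20 subr_gt0.
have he : `|h| < e.
  by rewrite ltr0_norm// opprK gt_min; apply/orP; left; lra.
have := eP h; rewrite /ball_/= sub0r normrN => /(_ he (ltr0_neq0 h0)).
set q := h^-1 *: _; rewrite ltr_norml => /andP[h1 _].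
have : q < 0 by move: h1; lra.
rewrite /q /GRing.scale/= mulr1 nmulr_rlt0 ?invr_lt0// subr_gt0 ltNge => /negP; apply.
apply: Fmax; apply/andP; split; last by rewrite gerDr ltW.
by rewrite -lerBlDr -lerN2 opprB opprK ge_min lexx orbT.
Qed.

Lemma continuous_bounded f (a b : R) : a <= b -> continuous f ->
  exists2 M : R, 0 <= M & forall t : R, t \in `[a, b] -> `|f t| <= M.
Proof.
move=> ab cf; have c : continuous (fun t => `|f t|).
  by move=> t; apply: continuous_comp; [exact: cf|exact: norm_continuous].
have [t0 t0I t0M] := EVT_max ab (@continuous_subspaceT _ _ _ _ c).
by exists `|f t0| => // t /t0M.
Qed.

Lemma finite_continuous_bounded (I : finType) (f : I -> R -> R) :
  (forall i, continuous (f i)) ->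
  exists2 M : R, 0 <= M & forall i (t : R), t \in `[0, 1] -> `|f i t| <= M.
Proof.
move=> cf; have bd i : exists M : R, 0 <= M /\
    forall t : R, t \in `[0, 1] -> `|f i t| <= M.
  have [M M0 fM] := continuous_bounded (ler01 : (0 : R) <= 1) (cf i).
  by exists M.
have [M MP] := choice bd; exists (\sum_i M i).
  by apply: sumr_ge0 => i _; have [] := MP i.
move=> i t t0; have [_ /(_ t t0)/le_trans] := MP i; apply.
by rewrite (bigD1 i)//= lerDl sumr_ge0// => j _; have [] := MP j.
Qed.

(** Compactness of the unit interval: the supremum of the [t] with [P 0 t] is
    attained and cannot be less than 1. *)
Lemma interval_induction (P : R -> R -> Prop) :
  (forall t, P t t) -> (forall s t u, P s t -> P t u -> P s u) ->
  (forall t0 : R, t0 \in `[0, 1] -> exists2 d : R, 0 < d &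
    forall s t : R, s \in `[0, 1] -> t \in `[0, 1] -> s <= t ->
    `|s - t0| < d -> `|t - t0| < d -> P s t) ->
  P 0 1.
Proof.
move=> Prefl Ptrans Ploc; pose S := [set t : R | t \in `[0, 1] /\ P 0 t].
have S0 : S 0 by split=> //; rewrite in_itv/= lexx ler01.
have S1 : ubound S 1 by move=> t []; rewrite in_itv/= => /andP[].
have supS : has_sup S by split; [exists 0|exists 1].
pose t0 := sup S.
have t00 : 0 <= t0 by apply: ub_le_sup => //; exists 1.
have t01 : t0 <= 1 by apply: sup_le_ub => //; exists 0.
have t0I : t0 \in `[0, 1] by rewrite in_itv/= t00.
have [d d0 dP] := Ploc t0 t0I.
have [s [sI P0s] ss] := sup_adherent d0 supS.
have st0 : s <= t0 by apply: ub_le_sup; [exists 1|split].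
pose t := Num.min (t0 + d / 2) 1.
have tle : t <= t0 + d / 2 by rewrite ge_min lexx.
have tge : t0 <= t by rewrite le_min t01 andbT; lra.
have tI : t \in `[0, 1].
  by rewrite in_itv/= (le_trans t00 tge)/= ge_min lexx orbT.
have Pst : P s t.
  have ss' : t0 - d < s by [].
  apply: dP => //; first exact: le_trans tge.
    by rewrite ltr_norml; apply/andP; split; lra.
  by rewrite ltr_norml; apply/andP; split; lra.
have P0t : P 0 t by exact: Ptrans Pst.
have tt0 : t <= t0 by apply: ub_le_sup; [exists 1|split].
suff <- : t = 1 by [].
by move: tt0; rewrite /t; case: (leP (t0 + d / 2) 1) => _; lra.
Qed.

Lemma cvg_pinfty_le (f h : R -> R) (l T : R) :
  (forall t, T <= t -> `|l - f t| <= h t) -> h t @[t --> +oo] --> 0 ->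
  f t @[t --> +oo] --> l.
Proof.
move=> fh h0; apply/cvgrPdist_le => e e0; near=> t.
apply: (@le_trans _ _ (h t)); last first.
  apply: le_trans (ler_norm _) _; rewrite -normrN -[- _]sub0r.
  by near: t; exact: (cvgrPdist_le _ _).1 h0 _ e0.
by apply: fh; near: t; exact: (nbhs_pinfty_ge (num_real _)).
Unshelve. all: by end_near. Qed.

Lemma cvg_pinfty_inv (K : R) : K / t @[t --> +oo] --> 0.
Proof.
rewrite -[X in _ --> X](mulr0 K); apply: cvgM; first exact: cvg_cst.
apply/cvgrPdist_le => e e0; near=> t.
have t0 : 0 < t by near: t; exact: (nbhs_pinfty_gt (num_real _)).
have te : e^-1 <= t by near: t; exact: (nbhs_pinfty_ge (num_real _)).
rewrite sub0r normrN normfV (gtr0_norm t0) -[leRHS]invrK.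
by rewrite lef_pV2 ?posrE ?invr_gt0.
Unshelve. all: by end_near. Qed.

Lemma expRN_le_inv (d b : R) : 0 < d -> 0 < b -> expR (- (b * d)) <= d^-1 / b.
Proof.
move=> d0 b0; rewrite expRN -invfM lef_pV2 ?posrE ?expR_gt0 ?mulr_gt0//.
by rewrite mulrC; have := expR_ge1Dx (b * d); lra.
Qed.

Lemma mul_expRN_le_inv (d b : R) : 0 < d -> 0 < b ->
  b * expR (- (b * d)) <= 4 / d ^+ 2 / b.
Proof.
move=> d0 b0; have d20 : 0 < d / 2 by lra.
have h := expRN_le_inv d20 b0.
have -> : expR (- (b * d)) = expR (- (b * (d / 2))) ^+ 2.
  by rewrite expr2 -expRD; congr expR; field.
apply: (@le_trans _ _ (b * ((d / 2)^-1 / b) ^+ 2)).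
  rewrite ler_wpM2l ?(ltW b0)// ler_sqr ?nnegrE ?expR_ge0//.
  exact: le_trans (expR_ge0 _) h.
by rewrite le_eqVlt; apply/orP; left; apply/eqP; field; rewrite !gt_eqF.
Qed.

End calculus.

Section primitives.
Variable R : realType.
Implicit Types f F : R -> R.

(** The lower bound of integration has to move with [t], since integrals are
    taken over sets and not over oriented intervals. *)
Definition primitive_from f (a t : R) : R :=
  \int[lebesgue_measure]_(s in `[- a, t]) f s -
  \int[lebesgue_measure]_(s in `[- a, 0]) f s.

Definition primitive f (t : R) : R := primitive_from f (`|t| + 1) t.

Lemma continuous_integrable_itv f (a b : R) : continuous f ->
  lebesgue_measure.-integrable `[a, b] (EFin \o f).
Proof.
move=> cf; apply: continuous_compact_integrable; first exact: segment_compact.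
exact: continuous_subspaceT.
Qed.

Lemma primitive_fromE f (a b t : R) : continuous f -> 0 <= a -> a <= b ->
  - a <= t -> primitive_from f b t = primitive_from f a t.
Proof.
move=> cf a0 ab at_; rewrite /primitive_from.
have K u : - a <= u -> \int[lebesgue_measure]_(s in `[- b, u]) f s =
    \int[lebesgue_measure]_(s in `[- a, u]) f s +
    \int[lebesgue_measure]_(s in `[- b, - a]) f s.
  move=> au; apply/eqP; rewrite -subr_eq; apply/eqP.
  rewrite Rintegral_itvB ?bnd_simp ?lerN2//; last exact: continuous_integrable_itv.
  rewrite Rintegral_itv_obnd_cbnd//.
  apply: integrableS (continuous_integrable_itv (- a) u cf) => //.
  exact: subset_itv_oc_cc.
by rewrite (K t)// (K 0) ?oppr_le0// opprD addrACA subrr addr0.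
Qed.

Lemma is_derive_primitive f (t : R) : continuous f ->
  is_derive t 1 (primitive f) (f t).
Proof.
move=> cf; have fE : {near t, primitive_from f (`|t| + 2) =1 primitive f}.
  near=> s; rewrite /primitive (@primitive_fromE _ (`|s| + 1))// ?addr_ge0//.
  - have : `|s| < `|t| + 1.
      rewrite -(subrK t s) (le_lt_trans (ler_normD _ _))// addrC ltrD2l.
      by near: s; exact: near_dist.
    lra.
  - by have := ler_norm (- s); rewrite normrN; lra.
have [||||d e] := @continuous_FTC1_closed R f (- (`|t| + 2)) t (t + 1).
- by rewrite ltrDl.
- exact: continuous_integrable_itv.
- by have := ler_norm (- t); rewrite normrN; lra.
- exact: cf.
pose G s := \int[lebesgue_measure]_(u in `[- (`|t| + 2), s]) f u.
have Gd : is_derive t 1 G (f t) by rewrite derive1E in e; exact: (DeriveDef d e).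
suff : is_derive t 1 (primitive_from f (`|t| + 2)) (f t).
  exact: near_eq_is_derive fE.
by have := is_deriveB Gd (is_derive_cst (G 0) t 1); rewrite subr0.
Unshelve. all: by end_near. Qed.

Lemma is_derive_reflect F (t d : R) : is_derive (- t) 1 F d ->
  is_derive t 1 (fun s => F (- s)) (- d).
Proof.
move=> Fd; rewrite -mulrN1.
by apply: (@is_derive1_comp _ F -%R); exact: is_deriveNid.
Qed.

(** The weight [expR (L * `|t|)] makes the integral operator of a linear equation
    with coefficients bounded by [L / 2] a contraction on the whole line. *)
Lemma le_primitive_expR F f (c L : R) : 0 <= c -> 0 <= L -> F 0 = 0 ->
  (forall t : R, is_derive t 1 F (f t)) ->
  (forall t : R, `|f t| <= c * L * expR (L * `|t|)) ->
  forall t : R, `|F t| <= c * expR (L * `|t|).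
Proof.
move=> c0 L0.
have pos : forall F f, F 0 = 0 -> (forall t : R, is_derive t 1 F (f t)) ->
    (forall t : R, `|f t| <= c * L * expR (L * `|t|)) ->
    forall t : R, 0 <= t -> F t <= c * expR (L * t).
  move=> {}F {}f F0 Fd fb t t0.
  have ed (s : R) : is_derive s 1 (fun s => c * expR (L * s)) (c * (expR (L * s) * L)).
    apply: is_deriveZ; apply: (@is_derive1_comp _ expR ( *%R L)).
    by rewrite -[X in is_derive _ _ _ X]mulr1; apply: is_deriveZ.
  have gd (s : R) : is_derive s 1 (fun s => c * expR (L * s) - F s)
      (c * (expR (L * s) * L) - f s) by apply: is_deriveB.
  have [s] := mean_value t0 (fun s _ => gd s).
  rewrite in_itv/= => /andP[s0 st].
  rewrite F0 mulr0 expR0 mulr1 !subr0 => e.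
  have h : 0 <= (c * (expR (L * s) * L) - f s) * t.
    rewrite mulr_ge0// subr_ge0 (le_trans (ler_norm _))// (le_trans (fb s))//.
    by rewrite (ger0_norm s0) mulrAC mulrA.
  by move: h; rewrite -e; lra.
have both : forall F f, F 0 = 0 -> (forall t : R, is_derive t 1 F (f t)) ->
    (forall t : R, `|f t| <= c * L * expR (L * `|t|)) ->
    forall t : R, 0 <= t -> `|F t| <= c * expR (L * `|t|).
  move=> {}F {}f F0 Fd fb t t0; rewrite (ger0_norm t0) ler_norml.
  rewrite (pos F f)// andbT lerNl.
  have Fd' (s : R) : is_derive s 1 (fun s => - F s) (- f s) by exact: is_deriveN.
  apply: (pos _ _ _ Fd') => //; first by rewrite F0 oppr0.
  by move=> s; rewrite normrN.
move=> F0 Fd fb t; have [t0|t0] := leP 0 t; first exact: both fb _ t0.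
have Fd' (s : R) : is_derive s 1 (fun s => F (- s)) (- f (- s)).
  exact: is_derive_reflect.
have := both (fun s => F (- s)) _ _ Fd' _ (- t).
rewrite oppr0 opprK normrN; apply=> //; last by rewrite oppr_ge0 ltW.
by move=> s; rewrite normrN -(normrN s).
Qed.

End primitives.

Section coordinates.
Variable R : realType.

Lemma normr_entry_le m n (x : 'M[R]_(m, n)) i j : `|x i j| <= `|x|.
Proof.
by rewrite [leRHS]/Num.Def.normr/= mx_normrE (le_bigmax _ _ (i, j)).
Qed.

Lemma cvg_mx_entries (T : Type) (F : set_system T) (FF : Filter F) k l
    (f : T -> 'M[R]_(k, l)) (x : 'M[R]_(k, l)) :
  (forall i j, f t i j @[t --> F] --> x i j) -> f t @[t --> F] --> x.
Proof.
move=> fx; apply/cvgrPdist_le => e e0; near=> t.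
rewrite /Num.Def.normr/= mx_normrE (bigmax_le _ (ltW e0))//= => i _.
rewrite !mxE/=; move: i; near: t; apply: filter_forall => /= i.
exact: ((cvgrPdist_le _ _).1 (fx i.1 i.2)).
Unshelve. all: by end_near. Qed.

Lemma is_derive_entry m n (f : R -> 'M[R]_(m, n)) (t : R) d i j :
  is_derive t 1 f d -> is_derive t 1 (fun s => f s i j) (d i j).
Proof.
move=> [fd <-]; have fij := (derivable_mxP f t 1).1 fd i j.
by rewrite derive_mx// mxE; exact: derivableP.
Qed.

Lemma is_derive_mx m n (f : R -> 'M[R]_(m, n)) (t : R) (d : 'M[R]_(m, n)) :
  (forall i j, is_derive t 1 (fun s => f s i j) (d i j)) -> is_derive t 1 f d.
Proof.
move=> fd; have df : derivable f t 1.
  by apply/derivable_mxP => i j; have [] := fd i j.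
apply: DeriveDef => //; rewrite derive_mx//; apply/matrixP => i j.
by rewrite mxE; have [_ ->] := fd i j.
Qed.

Lemma is_derive_fst (V W : normedModType R) (f : R -> V * W) (t : R) d :
  is_derive t 1 f d -> is_derive t 1 (fun s => (f s).1) d.1.
Proof.
move=> [fd fE]; have h : (fun h : R => h^-1 *: ((f (h *: 1 + t)).1 - (f t).1))
    @ 0^' --> d.1.
  rewrite -fE; apply: (@cvg_comp _ _ _ (fun h : R => h^-1 *: (f (h *: 1 + t) - f t))
    fst _ (nbhs ('D_1 f t)) (nbhs ('D_1 f t).1)); first exact: fd.
  exact: cvg_fst.
by apply: DeriveDef; [apply/cvg_ex; exists d.1|exact: cvg_lim h].
Qed.

Lemma is_derive_snd (V W : normedModType R) (f : R -> V * W) (t : R) d :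
  is_derive t 1 f d -> is_derive t 1 (fun s => (f s).2) d.2.
Proof.
move=> [fd fE]; have h : (fun h : R => h^-1 *: ((f (h *: 1 + t)).2 - (f t).2))
    @ 0^' --> d.2.
  rewrite -fE; apply: (@cvg_comp _ _ _ (fun h : R => h^-1 *: (f (h *: 1 + t) - f t))
    snd _ (nbhs ('D_1 f t)) (nbhs ('D_1 f t).2)); first exact: fd.
  exact: cvg_snd.
by apply: DeriveDef; [apply/cvg_ex; exists d.2|exact: cvg_lim h].
Qed.

Lemma is_derive_mulmx_col k l (U : R -> 'M[R]_(k, l)) (d : 'M[R]_(k, l))
    (x : 'cV[R]_l) (t : R) :
  (forall i j, is_derive t 1 (fun s => U s i j) (d i j)) ->
  forall i, is_derive t 1 (fun s => (U s *m x) i 0) ((d *m x) i 0).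
Proof.
move=> Ud i; under eq_fun do rewrite mxE; rewrite mxE.
apply: is_derive_bigsum => j _.
apply: is_derive_eq (is_deriveM (Ud i j) (is_derive_cst (x j 0) t 1)) _.
by rewrite scaler0 add0r /GRing.scale/= mulrC.
Qed.

End coordinates.

Section continuously_differentiable.
Variable R : realType.
Implicit Types f g df : R -> R.

Definition C1fun (f : R -> R) := exists2 df : R -> R, continuous df &
  forall t : R, is_derive t 1 f (df t).

Lemma C1fun_continuous f : C1fun f -> continuous f.
Proof. by move=> [df _ fd] t; exact: is_derive1_continuous (fd t). Qed.

Lemma C1fun_cst (a : R) : C1fun (fun=> a).
Proof. by exists (fun=> 0) => t; [exact: cvg_cst|exact: is_derive_cst]. Qed.

Lemma C1funD f g : C1fun f -> C1fun g -> C1fun (fun t => f t + g t).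
Proof.
move=> [df cf fd] [dg cg gd]; exists (fun t => df t + dg t) => t.
  by apply: cvgD; [exact: cf|exact: cg].
by apply: is_deriveD.
Qed.

Lemma C1funM f g : C1fun f -> C1fun g -> C1fun (fun t => f t * g t).
Proof.
move=> fC gC; have cf := C1fun_continuous fC; have cg := C1fun_continuous gC.
move: fC gC => [df cdf fd] [dg cdg gd].
exists (fun t => f t * dg t + g t * df t) => t; last exact: is_deriveM.
by apply: cvgD; apply: cvgM; [exact: cf|exact: cdg|exact: cg|exact: cdf].
Qed.

Lemma C1funN f : C1fun f -> C1fun (fun t => - f t).
Proof.
move=> /(C1funM (C1fun_cst (- 1))); congr C1fun.
by apply/funext => t; rewrite mulN1r.
Qed.

Lemma C1funB f g : C1fun f -> C1fun g -> C1fun (fun t => f t - g t).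
Proof. by move=> fC /C1funN; exact: C1funD. Qed.

Lemma C1fun_sum (I : Type) (r : seq I) (P : pred I) (h : I -> R -> R) :
  (forall i, C1fun (h i)) -> C1fun (fun t => \sum_(i <- r | P i) h i t).
Proof.
move=> hC; elim: r => [|i r IH].
  by under eq_fun do rewrite big_nil; exact: C1fun_cst.
by under eq_fun do rewrite big_cons; case: (P i) => //; exact: C1funD.
Qed.

Lemma C1fun_prod (I : Type) (r : seq I) (P : pred I) (h : I -> R -> R) :
  (forall i, C1fun (h i)) -> C1fun (fun t => \prod_(i <- r | P i) h i t).
Proof.
move=> hC; elim: r => [|i r IH].
  by under eq_fun do rewrite big_nil; exact: C1fun_cst.
by under eq_fun do rewrite big_cons; case: (P i) => //; exact: C1funM.
Qed.

Lemma C1funV f : (forall t, f t != 0) -> C1fun f ->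
  C1fun (fun t => (f t)^-1).
Proof.
move=> f0 fC; have cf := C1fun_continuous fC; move: fC => [df cdf fd].
exists (fun t => - (f t) ^- 2 *: df t) => t; last exact: is_deriveV.
apply: cvgM; last exact: cdf.
apply: cvgN; apply: cvgV; first by rewrite expf_neq0.
by apply: cvgM; exact: cf.
Qed.

Lemma C1fun_expR f : C1fun f -> C1fun (fun t => expR (f t)).
Proof.
move=> fC; have cf := C1fun_continuous fC; move: fC => [df cdf fd].
exists (fun t => expR (f t) * df t) => t; last first.
  exact: (@is_derive1_comp _ expR f).
apply: cvgM; last exact: cdf.
by apply: continuous_comp; [exact: cf|exact: continuous_expR].
Qed.

Lemma C1fun_det n (A : R -> 'M[R]_n) :
  (forall i j, C1fun (fun t => A t i j)) -> C1fun (fun t => \det (A t)).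
Proof.
move=> AC; apply: C1fun_sum => s; apply: C1funM; first exact: C1fun_cst.
exact: C1fun_prod.
Qed.

Lemma C1fun_mulmx m n p (A : R -> 'M[R]_(m, n)) (B : R -> 'M[R]_(n, p)) :
  (forall i j, C1fun (fun t => A t i j)) ->
  (forall i j, C1fun (fun t => B t i j)) ->
  forall i j, C1fun (fun t => (A t *m B t) i j).
Proof.
move=> AC BC i j; under eq_fun do rewrite mxE.
by apply: C1fun_sum => k; exact: C1funM.
Qed.

Lemma C1fun_invmx n (A : R -> 'M[R]_n) : (forall t, A t \in unitmx) ->
  (forall i j, C1fun (fun t => A t i j)) ->
  forall i j, C1fun (fun t => invmx (A t) i j).
Proof.
move=> uA AC i j; under eq_fun => t do rewrite /invmx uA !mxE.
apply: C1funM.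
  by apply: C1funV => [t|]; [rewrite -unitfE -unitmxE|exact: C1fun_det].
apply: C1funM; first exact: C1fun_cst.
by apply: C1fun_det => k l; under eq_fun do rewrite !mxE; exact: AC.
Qed.

Lemma C1fun_lipschitz f (a b : R) : a <= b -> C1fun f ->
  exists2 L : R, 0 <= L & forall s t : R, s \in `[a, b] -> t \in `[a, b] ->
    `|f s - f t| <= L * `|s - t|.
Proof.
move=> ab [df cdf fd]; have [L L0 dfL] := continuous_bounded ab cdf.
exists L => // s t sI tI; wlog st : s t sI tI / s <= t => [H|].
  have [/ltW|] := ltP s t; first exact: H.
  by rewrite distrC [`|s - t|]distrC; exact: H.
rewrite distrC [`|s - t|]distrC (@ger0_norm _ (t - s)) ?subr_ge0//.
apply: (@le_increment R f df) => // u; rewrite in_itv/= => /andP[su ut].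
apply: dfL; move: sI tI; rewrite !in_itv/= => /andP[a1 a2] /andP[b1 b2].
by rewrite (le_trans a1)// (le_trans ut).
Qed.

Lemma finite_lipschitz (I : finType) (f : I -> R -> R) :
  (forall i, C1fun (f i)) ->
  exists L : R, forall i (s t : R), s \in `[0, 1] -> t \in `[0, 1] ->
    `|f i s - f i t| <= L * `|s - t|.
Proof.
move=> fC; have lip i : exists L : R, 0 <= L /\ forall s t : R,
    s \in `[0, 1] -> t \in `[0, 1] -> `|f i s - f i t| <= L * `|s - t|.
  by have [L L0 fL] := C1fun_lipschitz (ler01 : (0 : R) <= 1) (fC i); exists L.
have [L LP] := choice lip; exists (\sum_i L i) => i s t s0 t0.
have [_ /(_ s t s0 t0)/le_trans] := LP i; apply; rewrite ler_wpM2r//.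
by rewrite (bigD1 i)//= lerDl sumr_ge0// => j _; have [] := LP j.
Qed.

Lemma finite_weight_bounds (I : finType) (h : I -> R -> R) :
  (forall i, C1fun (h i)) ->
  exists M : R, 0 < M /\ forall i (t : R), t \in `[0, 1] -> M^-1 <= expR (h i t) <= M.
Proof.
move=> hC; have [M M0 hM] :=
  finite_continuous_bounded (fun i => C1fun_continuous (hC i)).
exists (expR M); split=> [|i t t0]; first exact: expR_gt0.
by have := hM i t t0; rewrite ler_norml -expRN !ler_expR.
Qed.

End continuously_differentiable.

(** * Linear differential equations *)

Section sequences.
Variable R : realType.

Lemma ex_small_geometric (C e : R) : 0 < e -> exists k : nat, C / 2 ^+ k < e.
Proof.
move=> e0; pose k := (Num.truncn (`|C| / e)).+1; exists k.
have h : `|C| / e < 2 ^+ k.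
  apply: (@lt_trans _ _ k%:R); first exact: truncnS_gt.
  by rewrite -natrX ltr_nat ltn_expl.
rewrite ltr_pdivrMr ?exprn_gt0// (le_lt_trans (ler_norm _))//.
by rewrite mulrC -ltr_pdivrMr.
Qed.

(** Completeness without limits: the limit is squeezed between the
    nondecreasing [u k - 2 C / 2 ^ k] and the nonincreasing
    [u k + 2 C / 2 ^ k]. *)
Lemma geometric_limit (u : nat -> R) (C : R) :
  (forall k, `|u k.+1 - u k| <= C / 2 ^+ k) ->
  exists l, forall k, `|l - u k| <= 2 * C / 2 ^+ k.
Proof.
move=> uC; pose v k := 2 * C / 2 ^+ k.
have vS k : v k = 2 * v k.+1.
  by rewrite /v exprS invfM; field.
have vC k : v k = 2 * (C / 2 ^+ k) by rewrite /v mulrA.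
have C0 k : 0 <= C / 2 ^+ k by apply: le_trans (uC k).
have step k : (u k - v k <= u k.+1 - v k.+1) && (u k.+1 + v k.+1 <= u k + v k).
  have := vS k; have := vC k; have := uC k; rewrite ler_norml => /andP[].
  by move=> h1 h2 h3 h4; apply/andP; split; lra.
have lo j k : (j <= k)%N -> u j - v j <= u k - v k.
  move=> /subnK <-; elim: (k - j)%N => [//|i IH].
  by rewrite addSn (le_trans IH)//; have /andP[] := step (i + j)%N.
have hi j k : (j <= k)%N -> u k + v k <= u j + v j.
  move=> /subnK <-; elim: (k - j)%N => [//|i IH].
  by rewrite addSn (le_trans _ IH)//; have /andP[] := step (i + j)%N.
have v0 k : 0 <= v k by rewrite vC mulr_ge0.
have lohi j k : u j - v j <= u k + v k.
  have [/lo h|/ltnW/hi h] := leqP j k; have := v0 j; have := v0 k; lra.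
pose E := [set u k - v k | k in setT].
have Eub k : ubound E (u k + v k) by move=> _ [j _ <-]; exact: lohi.
exists (sup E) => k; rewrite ler_distl; apply/andP; split.
  apply: sup_ubound; first by exists (u 0%N + v 0%N); exact: Eub.
  by exists k.
by apply: sup_le_ub; [exists (u 0%N - v 0%N), 0%N|exact: Eub].
Qed.

End sequences.

Section linear_equation.
Variables (R : realType) (n m : nat).
Variables (A : R -> 'M[R]_n) (U0 : 'M[R]_(n, m)) (M : R).
Hypothesis cA : forall i j, continuous (fun t => A t i j).
Hypothesis bA : forall t i j, `|A t i j| <= M.

Definition picard (U : R -> 'M[R]_(n, m)) (t : R) : 'M[R]_(n, m) :=
  \matrix_(i, j) (U0 i j + (primitive (fun s => (A s *m U s) i j) t -
                            primitive (fun s => (A s *m U s) i j) 0)).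

Let contmx (U : R -> 'M[R]_(n, m)) := forall i j, continuous (fun t => U t i j).

Lemma is_derive_picard U : contmx U -> forall (t : R) i j,
  is_derive t 1 (fun s => picard U s i j) ((A t *m U t) i j).
Proof.
move=> cU t i j; under eq_fun do rewrite mxE.
have d := is_derive_primitive t (@continuous_mulmx _ _ _ _ A U cA cU i j).
have := is_deriveD (is_derive_cst (U0 i j) t 1)
  (is_deriveB d (is_derive_cst (primitive (fun s => (A s *m U s) i j) 0) t 1)).
by rewrite add0r subr0.
Qed.

Lemma picard0 U : picard U 0 = U0.
Proof. by apply/matrixP => i j; rewrite mxE subrr addr0. Qed.

Lemma continuous_picard U : contmx U -> contmx (picard U).
Proof.
by move=> cU i j t; apply: is_derive1_continuous; exact: is_derive_picard.
Qed.

Let L := 2 * n%:R * M + 1.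

Let M0 : 0 <= n%:R * M.
Proof.
have [->|n0] := posnP n; first by rewrite mul0r.
by rewrite mulr_ge0// (le_trans _ (bA 0 (Ordinal n0) (Ordinal n0))).
Qed.

Let L0 : 0 <= L. Proof. by rewrite /L -mulrA addr_ge0// mulr_ge0. Qed.

Lemma le_norm_mulmx (V : 'M[R]_(n, m)) t (c : R) :
  (forall i j, `|V i j| <= c) ->
  forall i j, `|(A t *m V) i j| <= n%:R * M * c.
Proof.
move=> Vc i j; rewrite mxE (le_trans (ler_norm_sum _ _ _))//.
rewrite -mulrA; apply: ler_sum_ord => k; by rewrite normrM ler_pM.
Qed.

Lemma picard_contraction U V (c : R) : contmx U -> contmx V -> 0 <= c ->
  (forall t i j, `|U t i j - V t i j| <= c * expR (L * `|t|)) ->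
  forall t i j, `|picard U t i j - picard V t i j| <= c / 2 * expR (L * `|t|).
Proof.
move=> cU cV c0 UV t i j.
have d (s : R) : is_derive s 1 (fun s => picard U s i j - picard V s i j)
    ((A s *m U s) i j - (A s *m V s) i j).
  exact: (is_deriveB (is_derive_picard cU s i j) (is_derive_picard cV s i j)).
apply: (le_primitive_expR _ L0 _ d) => [||s].
- by rewrite divr_ge0.
- by rewrite !picard0 subrr.
- have -> : (A s *m U s) i j - (A s *m V s) i j = (A s *m (U s - V s)) i j.
    by rewrite mulmxBr !mxE.
  have := @le_norm_mulmx (U s - V s) s (c * expR (L * `|s|)).
  move=> /(_ _ i j)/le_trans; apply; first by move=> k l; rewrite !mxE UV.
  rewrite mulrA ler_wpM2r ?expR_ge0// mulrC -subr_ge0.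
  have -> : c / 2 * L - c * (n%:R * M) = c / 2 by rewrite /L; field.
  by rewrite divr_ge0.
Qed.

(** The iterates of [picard] converge geometrically for the weighted norm of
    [le_primitive_expR]; as that norm lives on the whole line, so does the
    solution. *)
Lemma linear_equation_solution : exists U : R -> 'M[R]_(n, m), U 0 = U0 /\
  forall (t : R) i j, is_derive t 1 (fun s => U s i j) ((A t *m U t) i j).
Proof.
pose S k := iter k picard (cst U0).
have cS k : contmx (S k).
  elim: k => [i j t|k IH]; first exact: cvg_cst.
  exact: continuous_picard.
pose c := \sum_i \sum_j `|U0 i j|.
have c0 : 0 <= c by apply: sumr_ge0 => i _; exact: sumr_ge0.
have U0c i j : `|U0 i j| <= c.
  rewrite /c (bigD1 i)//= (bigD1 j)//= -addrA lerDl addr_ge0//.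
    exact: sumr_ge0.
  by apply: sumr_ge0 => k _; exact: sumr_ge0.
have Sstep k t i j : `|S k.+1 t i j - S k t i j| <= c / 2 ^+ k * expR (L * `|t|).
  elim: k t i j => [|k IH] t i j.
    rewrite expr0 divr1 /S /=.
    have d (s : R) : is_derive s 1 (fun s => picard (cst U0) s i j - U0 i j)
        ((A s *m U0) i j - 0).
      have cc : contmx (cst U0) by move=> ? ? ?; exact: cvg_cst.
      exact: (is_deriveB (is_derive_picard cc s i j)
        (is_derive_cst (U0 i j) s 1)).
    apply: (le_primitive_expR _ L0 _ d) => [//||s].
      by rewrite picard0 subrr.
    rewrite subr0 (le_trans (le_norm_mulmx s U0c i j))//.
    rewrite mulrC -mulrA ler_wpM2l// -[leLHS]mulr1 ler_pM//.
      by rewrite /L -subr_ge0; have := M0; lra.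
    by rewrite -expR0 ler_expR mulr_ge0.
  rewrite exprSr invfM mulrA.
  apply: (picard_contraction (cS k.+1) (cS k)) => //.
  by rewrite divr_ge0// exprn_ge0.
have lim t i j : exists l, forall k,
    `|l - S k t i j| <= 2 * c / 2 ^+ k * expR (L * `|t|).
  have [k|l lS] := @geometric_limit R (fun k => S k t i j) (c * expR (L * `|t|)).
    by rewrite mulrAC; exact: Sstep.
  by exists l => k; have := lS k; rewrite !mulrA; rewrite (mulrAC _ (expR _)).
pose U t : 'M[R]_(n, m) := \matrix_(i, j) sval (cid (lim t i j)).
have US t i j k : `|U t i j - S k t i j| <= 2 * c / 2 ^+ k * expR (L * `|t|).
  by rewrite mxE; exact: svalP (cid (lim t i j)) k.
have cU : contmx U.
  move=> i j; apply/continuous_epsP => t e e0.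
  have e3 : 0 < e / 4 by lra.
  have [k kE] := ex_small_geometric (2 * c * expR (L * (`|t| + 1))) e3.
  have b s : `|s| <= `|t| + 1 -> `|U s i j - S k s i j| <= e / 4.
    move=> st; rewrite (le_trans (US s i j k))// (le_trans _ (ltW kE))//.
    rewrite mulrAC ler_wpM2r ?invr_ge0 ?exprn_ge0// ler_wpM2l ?mulr_ge0//.
    by rewrite ler_expR ler_wpM2l.
  have [d d0 Sk] := (continuous_epsP _).1 (cS k i j) t _ e3.
  exists (Num.min d 1) => [|s]; first by rewrite lt_min d0 ltr01.
  rewrite lt_min => /andP[/Sk std st1].
  have /b : `|s| <= `|t| + 1.
    by rewrite -(subrK t s) (le_trans (ler_normD _ _))// addrC lerD2l ltW.
  have /b : `|t| <= `|t| + 1 by rewrite lerDl.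
  move: std; rewrite ltr_norml !ler_norml ltr_norml.
  move=> /andP[h1 h2] /andP[h3 h4] /andP[h5 h6].
  by apply/andP; split; lra.
have fix_ t i j : U t i j = picard U t i j.
  apply/eqP; rewrite eq_sym -subr_eq0 -normr_eq0 eq_le normr_ge0 andbT.
  apply/ler_addgt0Pr => e e0; rewrite add0r.
  have [k kE] := ex_small_geometric (2 * c * expR (L * `|t|)) e0.
  apply: le_trans (ltW kE).
  have h1 := US t i j k.+1.
  have h2 : `|picard U t i j - S k.+1 t i j| <=
      2 * c / 2 ^+ k / 2 * expR (L * `|t|).
    apply: picard_contraction => //.
    by rewrite divr_ge0 ?exprn_ge0// mulr_ge0.
  have -> : picard U t i j - U t i j =
    (picard U t i j - S k.+1 t i j) - (U t i j - S k.+1 t i j) by ring.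
  rewrite (le_trans (ler_normB _ _))// (le_trans (lerD h2 h1))//.
  rewrite exprSr invfM; set x := (2 ^+ k)^-1; set y := expR _.
  by rewrite le_eqVlt; apply/orP; left; apply/eqP; field.
exists U; split.
  by apply/matrixP => i j; rewrite fix_ picard0.
move=> t i j; rewrite [X in is_derive _ _ X _](_ : _ = fun s => picard U s i j).
  exact: is_derive_picard.
by apply/funext => s.
Qed.

End linear_equation.

(** * Flows on a graph and the response operator *)

Section matrix_complements.
Variable R : realType.

Lemma mul_row1E k l (y : 'M[R]_(k, l)) j :
  (const_mx 1 *m y : 'rV_l) 0 j = \sum_i y i j.
Proof. by rewrite mxE; apply: eq_bigr => i _; rewrite mxE mul1r. Qed.

Lemma invmx_eq n (A B : 'M[R]_n) : A *m B = 1%:M -> invmx A = B.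
Proof.
by move=> AB; have [uA _] := mulmx1_unit AB; rewrite -[LHS]mulmx1 -AB mulKmx.
Qed.

Lemma invmx_diag n (d : 'rV[R]_n) : (forall i, d 0 i != 0) ->
  invmx (diag_mx d) = diag_mx (\row_i (d 0 i)^-1).
Proof.
move=> d0; apply: invmx_eq; rewrite mulmx_diag -diag_const_mx; congr diag_mx.
by apply/rowP => i; rewrite !mxE mulfV.
Qed.

Lemma unitmx_inj_col n (A : 'M[R]_n) :
  (forall x : 'cV_n, A *m x = 0 -> x = 0) -> A \in unitmx.
Proof.
move=> A0; rewrite -unitmx_tr -row_free_unit; apply: inj_row_free => v vA.
by apply: trmx_inj; rewrite trmx0; apply: A0; rewrite -[A]trmxK -trmx_mul vA trmx0.
Qed.

Lemma row_full_inj_col m n (A : 'M[R]_(m, n)) :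
  (forall x : 'cV_n, A *m x = 0 -> x = 0) -> row_full A.
Proof.
move=> A0; rewrite /row_full -mxrank_tr; apply: inj_row_free => v vA.
by apply: trmx_inj; rewrite trmx0; apply: A0; rewrite -[A]trmxK -trmx_mul vA trmx0.
Qed.

(** The row of ones is a left eigenvector for the eigenvalue 1, and a matrix and
    its transpose have the same eigenvalues. *)
Lemma column_stochastic_fixpoint n (A : 'M[R]_n) : (0 < n)%N ->
  const_mx 1 *m A = const_mx 1 :> 'rV_n ->
  exists2 x : 'cV_n, x != 0 & A *m x = x.
Proof.
move=> n0 A1; have : \det (A - 1%:M)^T == 0.
  rewrite det_tr; apply/det0P; exists (const_mx 1).
    by apply/eqP => /rowP/(_ (Ordinal n0)); rewrite !mxE => /eqP; rewrite oner_eq0.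
  by rewrite mulmxBr A1 mulmx1 subrr.
move/det0P => [v v0 vA]; exists v^T.
  by apply: contra v0 => /eqP v0; rewrite -[v]trmxK v0 trmx0.
apply/eqP; rewrite -subr_eq0 -[X in _ - X]mul1mx -mulmxBl.
by rewrite -[_ - _]trmxK -trmx_mul vA trmx0.
Qed.

End matrix_complements.

Section potential_flows.
Variables (R : realType) (G : graph).
Local Notation n := (nvertices G).
Local Notation m := (nedges G).
Local Notation D := (@boundary R G).
Implicit Types (c : C1 R G) (p : C0 R G) (y : 'I_n -> R).

(** Summation by parts: the adjoint of the boundary is the coboundary. *)
Lemma sum_boundaryE y c :
  \sum_i y i * (D *m c) i 0 = \sum_a (y (d0 a) - y (d1 a)) * c a 0.
Proof.
under eq_bigr do rewrite mxE big_distrr/=.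
rewrite exchange_big/=; apply: eq_bigr => a _.
under eq_bigr do rewrite mxE mulrA mulrBr mulrBl.
rewrite sumrB mulrBl; congr (_ - _).
  rewrite (bigD1 (d0 a))//= eqxx mulr1 big1 ?addr0// => i.
  by rewrite eq_sym => /negbTE->; rewrite mulr0 mul0r.
rewrite (bigD1 (d1 a))//= eqxx mulr1 big1 ?addr0// => i.
by rewrite eq_sym => /negbTE->; rewrite mulr0 mul0r.
Qed.

Lemma sum_boundary0 c : \sum_i (D *m c) i 0 = 0.
Proof.
have := sum_boundaryE (fun=> 1) c.
under eq_bigr do rewrite mul1r.
by move=> ->; rewrite big1// => a _; rewrite subrr mul0r.
Qed.

Lemma row1_boundary : const_mx 1 *m D = 0 :> 'rV_m.
Proof.
apply/rowP => a; rewrite !mxE.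
under eq_bigr do rewrite !mxE mul1r.
have sum1 (k : 'I_n) : \sum_i (k == i)%:R = 1 :> R.
  by rewrite (bigD1 k)//= eqxx big1 ?addr0// => i /negbTE; rewrite eq_sym => ->.
by rewrite sumrB !sum1 subrr.
Qed.

(** The edges that leave a superlevel set of the potential all carry flow
    outwards, so no cancellation occurs in the flow balance of that set, and the
    flow of each of them is at most the total source. It is essential later that
    the bound is uniform in the conductances [w]. *)
Lemma le_potential_flow (w : 'I_m -> R) y c : (forall a, 0 < w a) ->
  (forall a, c a 0 = w a * (y (d0 a) - y (d1 a))) ->
  forall a, `|c a 0| <= \sum_i `|(D *m c) i 0|.
Proof.
move=> w0 cE a.
(* The superlevel set of the larger of the two end points of [a]. *)
pose th := Num.max (y (d0 a)) (y (d1 a)).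
pose s i : R := (th <= y i)%R%:R.
have s0 i : 0 <= s i by rewrite /s ler0n.
have s1 i : s i <= 1 by rewrite /s lern1; case: (th <= y i).
have cut b : 0 <= (s (d0 b) - s (d1 b)) * c b 0.
  rewrite cE mulrCA mulr_ge0 ?(ltW (w0 b))// /s.
  have [h0|h0] := leP th (y (d0 b)); have [h1|h1] := leP th (y (d1 b));
    rewrite /= ?subrr ?mul0r ?subr0 ?mul1r ?sub0r ?mulN1r//.
    by rewrite subr_ge0 ltW// (lt_le_trans h1).
  by rewrite oppr_ge0 subr_le0 ltW// (lt_le_trans h0).
have cuta : (s (d0 a) - s (d1 a)) * c a 0 = `|c a 0|.
  have := cut a; rewrite /s /th cE.
  have [h|h|->] := ltgtP (y (d0 a)) (y (d1 a)).
  - by rewrite lexx (lt_geF h)/= sub0r !mulN1r oppr_ge0 => /ler0_norm ->.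
  - by rewrite lexx (lt_geF h)/= subr0 !mul1r => /ger0_norm ->.
  - by rewrite !subrr mul0r mulr0 normr0.
rewrite -cuta; apply: (@le_trans _ _ (\sum_b (s (d0 b) - s (d1 b)) * c b 0)).
  by rewrite (bigD1 a)//= lerDl sumr_ge0.
rewrite -sum_boundaryE ler_sum// => i _.
rewrite (le_trans (ler_norm _))// normrM ger0_norm//.
by rewrite ler_piMl.
Qed.

Lemma le_potential_path y (e : R) : connected_graph G -> 0 <= e ->
  (forall a : 'I_m, `|y (d0 a) - y (d1 a)| <= e) ->
  forall i j, `|y i - y j| <= n%:R * e.
Proof.
move=> [_ cG] e0 ye i j.
have adj k l : adjacent k l -> `|y k - y l| <= e.
  move=> /existsP[a /orP[]/andP[/eqP<- /eqP<-]]; first exact: ye.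
  by rewrite distrC.
have /connectP[p0 p0P jE] := cG i j.
rewrite jE; case: (shortenP p0P) => p pP up _.
have path_le : forall q k, path (@adjacent G) k q ->
    `|y k - y (last k q)| <= (size q)%:R * e.
  elim=> [k _|l q IH k /= /andP[/adj kl /IH lq]].
    by rewrite subrr normr0 mul0r.
  rewrite -(subrKA (y l)) (le_trans (ler_normD _ _))// -natr1 mulrDl mul1r addrC.
  exact: lerD.
rewrite (le_trans (path_le _ _ pP))// ler_wpM2r// ler_nat.
have := max_card (mem (i :: p)); rewrite (card_uniqP up) card_ord.
exact: ltnW.
Qed.

(** A vector of zero sum has entries of both signs, so the oscillation of a
    positive rescaling of it bounds the rescaled vector itself. *)
Lemma le_potential (k : 'I_n -> R) p (e : R) : connected_graph G -> 0 <= e ->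
  (forall i, 0 < k i) -> \sum_i p i 0 = 0 ->
  (forall a : 'I_m, `|k (d0 a) * p (d0 a) 0 - k (d1 a) * p (d1 a) 0| <= e) ->
  forall i, k i * `|p i 0| <= n%:R * e.
Proof.
move=> cG e0 k0 p0 pe i.
have osc := le_potential_path (y := fun i => k i * p i 0) cG e0 pe.
have opp : exists j, p i 0 * p j 0 <= 0.
  apply: contrapT => /forallNP/= h.
  have : 0 < \sum_j p i 0 * p j 0.
    have pos j : 0 < p i 0 * p j 0 by rewrite ltNge; apply/negP.
    by rewrite (bigD1 i)//= ltr_wpDr// sumr_ge0// => j _; exact: ltW.
  by rewrite -mulr_sumr p0 mulr0 ltxx.
have [j pij] := opp.
apply: le_trans (osc i j); rewrite -[leLHS](ger0_norm _) ?mulr_ge0 ?(ltW (k0 i))//.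
rewrite normrM normr_id -normrM -ler_sqr ?nnegrE// !real_normK ?num_real// sqrrB.
have : (k i * p i 0) * (k j * p j 0) <= 0.
  by rewrite mulrACA mulr_ge0_le0// mulr_ge0// ltW.
have := sqr_ge0 (k j * p j 0); lra.
Qed.

End potential_flows.

Section generator.
Variables (R : realType) (G : graph).
Local Notation n := (nvertices G).
Local Notation m := (nedges G).
Local Notation D := (@boundary R G).
Implicit Types (b : R) (x : params R G) (p : C0 R G).

Lemma flux_entry b x a i : flux b x a i =
  expR (- (b * x.2 0 a)) * D i a * expR (b * x.1 0 i).
Proof.
rewrite /flux /ghat invmx_diag => [|j]; last by rewrite mxE gt_eqF ?expR_gt0.
by rewrite /kappahat mul_mx_diag mul_diag_mx !mxE expRN.
Qed.

Lemma fluxE b x p a : (flux b x *m p) a 0 = expR (- (b * x.2 0 a)) *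
  (expR (b * x.1 0 (d0 a)) * p (d0 a) 0 - expR (b * x.1 0 (d1 a)) * p (d1 a) 0).
Proof.
rewrite mxE; under eq_bigr do rewrite flux_entry mxE -!mulrA.
rewrite -mulr_sumr; congr (_ * _); under eq_bigr do rewrite mulrBl.
rewrite sumrB; congr (_ - _).
  rewrite (bigD1 (d0 a))//= eqxx mul1r big1 ?addr0// => i.
  by rewrite eq_sym => /negbTE->; rewrite mul0r.
rewrite (bigD1 (d1 a))//= eqxx mul1r big1 ?addr0// => i.
by rewrite eq_sym => /negbTE->; rewrite mul0r.
Qed.

Lemma masterE b x p : master b x *m p = - (D *m (flux b x *m p)).
Proof. by rewrite /master mulNmx mulmxA. Qed.

Lemma row1_master b x : const_mx 1 *m master b x = 0 :> 'rV_n.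
Proof. by rewrite /master mulmxN mulmxA row1_boundary mul0mx oppr0. Qed.

Lemma sum_master b x p : \sum_i (master b x *m p) i 0 = 0.
Proof.
rewrite masterE; under eq_bigr do rewrite mxE.
by rewrite sumrN sum_boundary0 oppr0.
Qed.

(** Detailed balance: for the weights [expR (b * E_i)] the master operator is
    symmetric, and its quadratic form is minus the dissipation in the edges. *)
Lemma dissipation b x p :
  \sum_i expR (b * x.1 0 i) * p i 0 * (master b x *m p) i 0 =
  - \sum_a expR (- (b * x.2 0 a)) * (expR (b * x.1 0 (d0 a)) * p (d0 a) 0 -
      expR (b * x.1 0 (d1 a)) * p (d1 a) 0) ^+ 2.
Proof.
rewrite masterE; under eq_bigr do rewrite [X in _ * X]mxE mulrN.
rewrite sumrN (sum_boundaryE (fun i => expR (b * x.1 0 i) * p i 0)).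
by congr (- _); apply: eq_bigr => a _; rewrite fluxE expr2 mulrCA.
Qed.

Definition partition_function b x : R := \sum_i expR (- (b * x.1 0 i)).

Definition boltzmann b x : C0 R G :=
  \col_i (expR (- (b * x.1 0 i)) / partition_function b x).

(** Adding the rank-one matrix that projects onto the equilibrium makes the
    master operator invertible without changing it on vectors of zero sum. *)
Definition regular_master b x : 'M[R]_n :=
  master b x + boltzmann b x *m const_mx 1.

(** The operator A of adiabatic response: on vectors of zero sum, the right
    inverse of minus the boundary with values in the image of [flux]. *)
Definition response b x : 'M[R]_(m, n) :=
  flux b x *m invmx (regular_master b x).

Hypothesis cG : connected_graph G.

Lemma partition_function_gt0 b x : 0 < partition_function b x.
Proof.
have [n0 _] := cG; rewrite /partition_function (bigD1 (Ordinal n0))//=.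
by rewrite ltr_pwDl ?expR_gt0// sumr_ge0// => i _; exact: expR_ge0.
Qed.

Lemma sum_boltzmann b x : \sum_i boltzmann b x i 0 = 1.
Proof.
under eq_bigr do rewrite mxE.
by rewrite -mulr_suml divff// gt_eqF ?partition_function_gt0.
Qed.

Lemma boltzmann_gt0 b x i : 0 < boltzmann b x i 0.
Proof. by rewrite mxE divr_gt0 ?expR_gt0 ?partition_function_gt0. Qed.

Lemma boltzmann_le1 b x i : boltzmann b x i 0 <= 1.
Proof.
rewrite -(sum_boltzmann b x) (bigD1 i)//= lerDl sumr_ge0// => j _.
exact/ltW/boltzmann_gt0.
Qed.

Lemma flux_boltzmann b x : flux b x *m boltzmann b x = 0.
Proof.
apply/colP => a; rewrite fluxE !mxE.
have K z : expR z * (expR (- z) / partition_function b x) =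
    (partition_function b x)^-1 by rewrite mulrA -expRD subrr expR0 mul1r.
by rewrite !K subrr mulr0.
Qed.

Lemma flux_le_master b x p a :
  `|(flux b x *m p) a 0| <= \sum_i `|(master b x *m p) i 0|.
Proof.
under eq_bigr do rewrite masterE mxE normrN.
apply: (@le_potential_flow R G (fun a => expR (- (b * x.2 0 a)))
  (fun i => expR (b * x.1 0 i) * p i 0)) => [?|?]; first exact: expR_gt0.
exact: fluxE.
Qed.

Lemma master_inj b x p : \sum_i p i 0 = 0 -> master b x *m p = 0 -> p = 0.
Proof.
move=> p0 Hp; apply/colP => i; rewrite mxE; apply/eqP.
rewrite -normr_eq0 -(mulrI_eq0 _ (mulfI (lt0r_neq0 (expR_gt0 (b * x.1 0 i))))).
rewrite eq_le mulr_ge0 ?expR_ge0// andbT -[leRHS](mulr0 n%:R).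
apply: (@le_potential R G (fun i => expR (b * x.1 0 i))) => // [j|a].
  exact: expR_gt0.
have := flux_le_master b x p a; rewrite Hp big1 => [|j _]; last first.
  by rewrite mxE normr0.
by rewrite fluxE normrM pmulr_rle0// normr_gt0 gt_eqF ?expR_gt0.
Qed.

Lemma regular_masterE b x p :
  regular_master b x *m p = master b x *m p + (\sum_i p i 0) *: boltzmann b x.
Proof.
rewrite mulmxDl -mulmxA; congr (_ + _); apply/colP => i.
rewrite !mxE big_ord1 !mxE mulrC; congr (_ * _).
by apply: eq_bigr => j _; rewrite mxE mul1r.
Qed.

Lemma sum_regular_master b x p :
  \sum_i (regular_master b x *m p) i 0 = \sum_i p i 0.
Proof.
rewrite regular_masterE; under eq_bigr do rewrite mxE [X in _ + X]mxE.
by rewrite big_split/= sum_master add0r -mulr_sumr sum_boltzmann mulr1.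
Qed.

Lemma regular_master_unit b x : regular_master b x \in unitmx.
Proof.
apply: unitmx_inj_col => p Np.
have p0 : \sum_i p i 0 = 0.
  by rewrite -(sum_regular_master b x) Np big1// => i _; rewrite mxE.
apply: (master_inj (b := b) (x := x)) => //.
by move: Np; rewrite regular_masterE p0 scale0r addr0.
Qed.

Lemma response_master b x p : \sum_i p i 0 = 0 ->
  response b x *m (master b x *m p) = flux b x *m p.
Proof.
move=> p0; have -> : master b x *m p = regular_master b x *m p.
  by rewrite regular_masterE p0 scale0r addr0.
by rewrite /response -mulmxA mulKmx// regular_master_unit.
Qed.

Lemma response_flux b x p : \sum_i p i 0 = 0 ->
  exists q : C0 R G, [/\ \sum_i q i 0 = 0, master b x *m q = p &
    response b x *m p = flux b x *m q].
Proof.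
move=> p0; exists (invmx (regular_master b x) *m p).
set q := invmx _ *m p; have Nq : regular_master b x *m q = p.
  by rewrite mulKVmx// regular_master_unit.
have q0 : \sum_i q i 0 = 0 by rewrite -(sum_regular_master b x) Nq.
split=> //; last by rewrite /response mulmxA.
by rewrite -[RHS]Nq regular_masterE q0 scale0r addr0.
Qed.

Lemma boundary_response b x p : \sum_i p i 0 = 0 ->
  D *m (response b x *m p) = - p.
Proof.
by move=> /(response_flux b x)[q [_ <- ->]]; rewrite masterE opprK.
Qed.

Lemma le_response b x p a : \sum_i p i 0 = 0 ->
  `|(response b x *m p) a 0| <= \sum_i `|p i 0|.
Proof.
by move=> /(response_flux b x)[q [_ <- ->]]; exact: flux_le_master.
Qed.

Lemma response_cycle b x p (z : C1 R G) : \sum_i p i 0 = 0 -> D *m z = 0 ->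
  \sum_a expR (b * x.2 0 a) * (response b x *m p) a 0 * z a 0 = 0.
Proof.
move=> /(response_flux b x)[q [_ _ ->]] Dz.
have := sum_boundaryE (fun i => expR (b * x.1 0 i) * q i 0) z.
rewrite Dz big1 => [e|i _]; last by rewrite mxE mulr0.
rewrite [RHS]e.
apply: eq_bigr => a _; rewrite fluxE.
by rewrite mulrA -expRD subrr expR0 mul1r.
Qed.

End generator.

(** * The response for widely separated barriers *)

Section low_temperature_response.
Variable R : realType.
Variables (n m : nat) (D : 'M[R]_(n, m)).

(** The edges that a minimal spanning tree avoids: those that come last on
    some cycle, when the edges are ordered by [lt]. *)
Definition closes_cycle (lt : rel 'I_m) (a : 'I_m) : Prop :=
  exists z : 'cV[R]_m, [/\ D *m z = 0, z a 0 = 1 &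
    forall b, z b 0 != 0 -> b = a \/ lt b a].

(** [L] is the response along the minimal spanning tree of the order [lt]. It is
    characterized by what it is needed for: it approximates every flow [c] that
    is orthogonal to the cycles for weights [w] increasing along [lt], with an
    error of the order of the ratio [e] of the weights of successive edges. *)
Definition tree_response (lt : rel 'I_m) (L : 'M[R]_(m, n)) : Prop :=
  exists2 K : R, 0 <= K & forall (w : 'I_m -> R) (e N : R) (c : 'cV[R]_m),
    (forall a, 0 < w a) -> 0 <= e -> (forall a b, lt a b -> w a <= e * w b) ->
    (forall a, `|c a 0| <= N) ->
    (forall z : 'cV[R]_m, D *m z = 0 -> \sum_a w a * c a 0 * z a 0 = 0) ->
    forall a, `|c a 0 + (L *m (D *m c)) a 0| <= K * e * N.

(** Orthogonality to the cycle that [a] closes expresses [c a] by the values of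
    [c] on edges of much smaller weight. *)
Lemma closes_cycle_bound (lt : rel 'I_m) a : closes_cycle lt a ->
  exists2 K : R, 0 <= K & forall (w : 'I_m -> R) (e N : R) (c : 'cV[R]_m),
    (forall a, 0 < w a) -> 0 <= e -> (forall a b, lt a b -> w a <= e * w b) ->
    (forall a, `|c a 0| <= N) ->
    (forall z : 'cV[R]_m, D *m z = 0 -> \sum_a w a * c a 0 * z a 0 = 0) ->
    `|c a 0| <= K * e * N.
Proof.
move=> [z [Dz za zlt]]; exists (\sum_(b | b != a) `|z b 0|).
  exact: sumr_ge0.
move=> w e N c w0 e0 wlt cN /(_ z Dz); rewrite (bigD1 a)//= za mulr1 => /eqP.
rewrite addr_eq0 => /eqP wc.
have N0 : 0 <= N by apply: le_trans (cN a).
rewrite -(ler_pM2l (w0 a)) -[X in X * `|_|](gtr0_norm (w0 a)) -normrM wc normrN.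
rewrite (le_trans (ler_norm_sum _ _ _))// -mulrA mulr_suml mulr_sumr.
apply: ler_sum => b ba; rewrite !normrM (gtr0_norm (w0 b)).
have [->|zb] := eqVneq (z b 0) 0; first by rewrite normr0 mulr0 mul0r mulr0.
have [/eqP|/wlt wba] := zlt b zb; first by rewrite (negbTE ba).
rewrite mulrC [leRHS]mulrCA ler_wpM2l// mulrA [w a * e]mulrC.
by rewrite ler_pM// ltW.
Qed.

(** The only cycle that avoids all edges closing a cycle is 0, since the last
    edge of its support would close a cycle. Hence a flow is a linear function
    of its source and of its values on the edges closing a cycle; the latter are
    negligible by [closes_cycle_bound], and [L] is the dependence on the
    source. *)
Lemma ex_tree_response (W : 'I_m -> R) : injective W ->
  exists L, tree_response (fun a b => W a < W b) L.
Proof.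
move=> injW; set lt : rel 'I_m := fun a b => W a < W b.
pose Pi : 'M[R]_m := diag_mx (\row_a (`[< closes_cycle lt a >])%:R).
have PiE (c : 'cV_m) a : (Pi *m c) a 0 = (`[< closes_cycle lt a >])%:R * c a 0.
  by rewrite /Pi mul_diag_mx !mxE.
have full : row_full (col_mx D Pi).
  apply: row_full_inj_col => z; rewrite mul_col_mx => /eqP.
  rewrite col_mx_eq0 => /andP[/eqP Dz /eqP Piz]; apply: contrapT => z0.
  have [a0 za0] : exists a, z a 0 != 0.
    apply: contrapT => /forallNP h; apply: z0; apply/colP => a.
    by rewrite mxE; have /negP := h a; rewrite negbK => /eqP.
  have [a za amax] := @arg_maxP _ _ _ a0 (fun a => z a 0 != 0) W za0.
  have ca : closes_cycle lt a.
    exists ((z a 0)^-1 *: z); split; first by rewrite -scalemxAr Dz scaler0.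
      by rewrite mxE mulVf.
    move=> b; rewrite mxE mulf_eq0 negb_or => /andP[_ /amax Wba].
    have [->|ba] := eqVneq b a; [by left|right].
    rewrite /lt lt_neqAle (Wba : W b <= W a) andbT.
    by apply: contra ba => /eqP/injW ->.
  have /colP/(_ a) := Piz; rewrite PiE mxE (asboolT ca) mul1r => za1.
  by rewrite za1 eqxx in za.
have [B BE] := row_fullP full.
pose L1 := lsubmx B; pose L2 := rsubmx B.
have L12 (c : 'cV_m) : c = L1 *m (D *m c) + L2 *m (Pi *m c).
  rewrite !mulmxA -mulmxDl -mul_row_col hsubmxK.
  by rewrite BE mul1mx.
have [K K0 KP] : exists2 K : 'I_m -> R, (forall a, 0 <= K a) & forall a,
    closes_cycle lt a -> forall (w : 'I_m -> R) (e N : R) (c : 'cV[R]_m),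
    (forall a, 0 < w a) -> 0 <= e -> (forall a b, lt a b -> w a <= e * w b) ->
    (forall a, `|c a 0| <= N) ->
    (forall z : 'cV[R]_m, D *m z = 0 -> \sum_a w a * c a 0 * z a 0 = 0) ->
    `|c a 0| <= K a * e * N.
  have h a : exists K : R, 0 <= K /\ (closes_cycle lt a ->
      forall (w : 'I_m -> R) (e N : R) (c : 'cV[R]_m),
    (forall a, 0 < w a) -> 0 <= e -> (forall a b, lt a b -> w a <= e * w b) ->
    (forall a, `|c a 0| <= N) ->
    (forall z : 'cV[R]_m, D *m z = 0 -> \sum_a w a * c a 0 * z a 0 = 0) ->
    `|c a 0| <= K * e * N).
    have [/closes_cycle_bound[K K0 KP]|nc] := pselect (closes_cycle lt a).
      by exists K.
    by exists 0.
  by have [K KP] := choice h; exists K => a; have [] := KP a.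
exists (- L1).
exists (\sum_a \sum_b `|L2 a b| * K b).
  by apply: sumr_ge0 => a _; apply: sumr_ge0 => b _; rewrite mulr_ge0.
move=> w e N c w0 e0 wlt cN orth a.
have -> : c a 0 + (- L1 *m (D *m c)) a 0 = (L2 *m (Pi *m c)) a 0.
  have /colP/(_ a) := L12 c; rewrite [RHS]mxE => cE.
  by rewrite mulNmx [X in _ + X]mxE [X in X + _]cE addrAC subrr add0r.
have N0 : 0 <= N by apply: le_trans (cN a).
have eN : 0 <= e * N by rewrite mulr_ge0.
have Pic b : `|(Pi *m c) b 0| <= K b * (e * N).
  rewrite PiE; have [cb|ncb] := pselect (closes_cycle lt b).
    by rewrite asboolT// mul1r mulrA; exact: KP.
  by rewrite asboolF// mul0r normr0 mulr_ge0.
rewrite -mulrA mxE (le_trans (ler_norm_sum _ _ _))//.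
apply: (@le_trans _ _ (\sum_b `|L2 a b| * K b * (e * N))).
  by apply: ler_sum => b _; rewrite normrM -mulrA ler_wpM2l.
rewrite -mulr_suml ler_wpM2r// [leRHS](bigD1 a)//= lerDl.
by apply: sumr_ge0 => a' _; apply: sumr_ge0 => b _; rewrite mulr_ge0.
Qed.

End low_temperature_response.

(** * Loops and their generic perturbations *)

Section loop_coordinates.
Variables (R : realType) (G : graph).
Implicit Types (x : params R G) (g h : loop R G).

Lemma loop_one_zero g : g 1 = g 0.
Proof. by rewrite -(loop_periodic g 0) add0r. Qed.

Lemma loop_periodic_nat g (t : R) k : g (t + k%:R) = g t.
Proof. by elim: k => [|k IH]; rewrite ?addr0// -natr1 addrA loop_periodic. Qed.

Lemma loop_reduce g (t : R) : exists2 s : R, s \in `[0, 1] & g t = g s.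
Proof.
exists (t - (Num.floor t)%:~R).
  rewrite in_itv/= subr_ge0 ge_floor ?num_real//= lerBlDl ltW//.
  by rewrite -[1]/(1%:~R) -intrD lt_succ_floor ?num_real.
case: (Num.floor t) => k; last first.
  by rewrite NegzE mulrNz opprK loop_periodic_nat.
by rewrite -[in LHS](subrK k%:R t) loop_periodic_nat.
Qed.

Lemma energy_le_norm x i : `|x.1 0 i| <= `|x|.
Proof. by rewrite prod_normE le_max normr_entry_le. Qed.

Lemma barrier_le_norm x a : `|x.2 0 a| <= `|x|.
Proof. by rewrite prod_normE le_max normr_entry_le orbT. Qed.

Lemma loop_derivable g (t : R) : is_derive t 1 g (derive1n 1 g t).
Proof. by rewrite derive1n1 derive1E; apply/derivableP/(@loop_smooth _ _ g 0). Qed.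

Lemma loop_derive1_derivable g (t : R) :
  is_derive t 1 (derive1n 1 g) (derive1n 2 g t).
Proof.
have := derivableP (@loop_smooth _ _ g 1 t).
by rewrite -derive1E -[(derive1n 1 g)^`()%classic]derive1nS.
Qed.

Lemma is_derive_energy g (t : R) i :
  is_derive t 1 (fun s => (g s).1 0 i) ((derive1n 1 g t).1 0 i).
Proof.
by apply: is_derive_entry; apply: is_derive_fst; exact: loop_derivable.
Qed.

Lemma continuous_velocity g i : continuous (fun t => (derive1n 1 g t).1 0 i).
Proof.
move=> t; apply: is_derive1_continuous; apply: is_derive_entry.
by apply: is_derive_fst; exact: loop_derive1_derivable.
Qed.

Lemma C1fun_energy g i : C1fun (fun t => (g t).1 0 i).
Proof.
exists (fun t => (derive1n 1 g t).1 0 i); first exact: continuous_velocity.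
by move=> t; exact: is_derive_energy.
Qed.

Lemma C1fun_barrier g a : C1fun (fun t => (g t).2 0 a).
Proof.
exists (fun t => (derive1n 1 g t).2 0 a) => t.
  apply: is_derive1_continuous; apply: is_derive_entry; apply: is_derive_snd.
  exact: loop_derive1_derivable.
by apply: is_derive_entry; apply: is_derive_snd; exact: loop_derivable.
Qed.

Lemma loop_continuous g (t0 e : R) : 0 < e -> exists2 d : R, 0 < d &
  forall t : R, `|t - t0| < d -> `|g t - g t0| < e.
Proof.
move=> e0; have [gd _] := loop_derivable g t0.
have cg : {for t0, continuous g}.
  exact/differentiable_continuous/derivable1_diffP.
have /nbhs_ballP[d d0 dP] : \forall t \near t0, `|g t0 - g t| < e.
  exact: (cvgrPdist_lt _ _).1 cg _ e0.
by exists d => // t tt0; rewrite distrC; apply: dP; rewrite /ball/= distrC.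
Qed.

Lemma uniformly_close g (t0 e : R) : 0 < e -> exists2 d : R, 0 < d &
  forall h (t : R), Ck_ball g 0 e h -> t \in `[0, 1] -> `|t - t0| < d ->
    `|h t - g t0| < 2 * e.
Proof.
move=> e0; have [d d0 dP] := loop_continuous g t0 e0; exists d => // h t gh t01 tt0.
have /(_ t t01) := gh 0%N isT; rewrite /= => gh0.
rewrite -(subrKA (g t)) (le_lt_trans (ler_normD _ _))// mulr2n mulrDl mul1r.
by apply: ltrD; [rewrite distrC|exact: dP].
Qed.

Lemma derive1n_addcst (V : normedModType R) (f : R -> V) (c : V) k :
  (forall t : R, derivable f t 1) ->
  derive1n k.+1 (fun t => f t + c) = derive1n k.+1 f.
Proof.
move=> fd; elim: k => [|k IH].
  apply/funext => t; rewrite !derive1n1 !derive1E deriveD//.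
  by rewrite derive_cst addr0.
by rewrite derive1nS IH.
Qed.

Lemma translate_smooth g (x : params R G) k (t : R) :
  derivable (derive1n k (fun t => g t + x)) t 1.
Proof.
case: k => [|k]; first by apply: derivableD => //; exact: (@loop_smooth _ _ g 0).
rewrite derive1n_addcst; first exact: loop_smooth.
exact: (@loop_smooth _ _ g 0).
Qed.

Lemma translate_periodic g (x : params R G) (t : R) : g (t + 1) + x = g t + x.
Proof. by rewrite loop_periodic. Qed.

Definition translate_loop g (x : params R G) : loop R G :=
  @Loop R G _ (@translate_smooth g x) (translate_periodic g x).

Lemma translate_loop_Ck_ball g x k (e : R) : `|x| < e ->
  Ck_ball g k e (translate_loop g x).
Proof.
move=> xe [|j] _ t _; first by rewrite /= opprD addNKr normrN.
rewrite derive1n_addcst ?subrr ?normr0 ?(le_lt_trans _ xe)// => s.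
exact: (@loop_smooth _ _ g 0).
Qed.

End loop_coordinates.

Section avoidance.
Variable R : realType.

Lemma eq_mod_close (p q d : nat) : (p <= q)%N -> (q - p <= d)%N ->
  p = q %[mod d.+1] -> p = q.
Proof.
move=> pq qpd /esym/eqP; rewrite eqn_mod_dvd// => /dvdn_leq h.
apply/eqP; rewrite eqn_leq pq -subn_eq0 /=; apply: contraT.
by rewrite -lt0n => /h/leq_trans/(_ qpd); rewrite ltnn.
Qed.

(** On a grid of side [M] there are [M ^ 2] points, while a curve cut into [M]
    pieces passes through boundedly many points of the grid in each piece: a
    point is determined by the curve, the piece, and the residues of its
    coordinates modulo [d.+1], where [d] bounds the number of grid steps that a
    piece can make. So the curves miss a point of the grid if [M] is large. *)
Lemma curves_avoid_point (I : finType) (f1 f2 : I -> R -> R) (L eta : R) :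
  0 < eta ->
  (forall i (s t : R), s \in `[0, 1] -> t \in `[0, 1] ->
    `|f1 i s - f1 i t| <= L * `|s - t|) ->
  (forall i (s t : R), s \in `[0, 1] -> t \in `[0, 1] ->
    `|f2 i s - f2 i t| <= L * `|s - t|) ->
  exists u v : R, [/\ 0 <= u <= eta, 0 <= v <= eta &
    forall i (t : R), t \in `[0, 1] -> f1 i t = u -> f2 i t = v -> False].
Proof.
move=> eta0 f1L f2L; pose d := Num.truncn (`|L| / eta).
(* [K * M.+1] bounds the number of codes, so [M] makes it less than [M ^ 2]. *)
pose K := (#|I| * (d.+1 * d.+1))%N; pose M := (2 * K).+1.
have M0 : 0 < M%:R :> R by rewrite ltr0n.
pose pt (p : 'I_M) : R := eta * (p%:R / M%:R).
have pt_itv p : 0 <= pt p <= eta.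
  rewrite /pt mulr_ge0 ?(ltW eta0) ?divr_ge0//= ler_piMr ?(ltW eta0)//.
  by rewrite ler_pdivrMr// mul1r ler_nat ltnW.
suff [p [q pq]] : exists p q : 'I_M, forall i (t : R), t \in `[0, 1] ->
    f1 i t = pt p -> f2 i t = pt q -> False by exists (pt p), (pt q).
apply: contrapT => none.
have hit (pq : 'I_M * 'I_M) : exists it : I * R, [/\ it.2 \in `[0, 1],
    f1 it.1 it.2 = pt pq.1 & f2 it.1 it.2 = pt pq.2].
  apply: contrapT => /forallNP h; apply: none; exists pq.1, pq.2 => i t t01 e1 e2.
  by apply: (h (i, t)).
have [F FP] := choice hit.
pose piece (t : R) : 'I_M.+1 := inord (Num.truncn (t * M%:R)).
pose code pq := ((F pq).1, piece (F pq).2,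
  (inord (pq.1 %% d.+1) : 'I_d.+1, inord (pq.2 %% d.+1) : 'I_d.+1)).
have pieceP (s t : R) : s \in `[0, 1] -> t \in `[0, 1] -> piece s = piece t ->
    `|s - t| * M%:R <= 1.
  have tr (u : R) : u \in `[0, 1] -> (Num.truncn (u * M%:R) < M.+1)%N /\
      (Num.truncn (u * M%:R))%:R <= u * M%:R < (Num.truncn (u * M%:R)).+1%:R.
    rewrite in_itv/= => /andP[u0 u1].
    have uM0 : 0 <= u * M%:R by rewrite mulr_ge0// ltW.
    have itv := truncn_itv uM0; split=> //; rewrite ltnS -(ler_nat R).
    have /andP[h _] := itv; rewrite (le_trans h)// ler_piMl// ltW.
  move=> /tr[sM /andP[s1 s2]] /tr[tM /andP[t1 t2]] /(congr1 val) /=.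
  rewrite /piece !inordK// => e.
  rewrite -[X in _ * X](gtr0_norm M0) -normrM.
  rewrite mulrBl ler_norml; move: s1 s2; rewrite e -natr1 => s1 s2.
  by move: t1 t2; rewrite -natr1 => t1 t2; apply/andP; split; lra.
have close (p q : 'I_M) (f : I -> R -> R) i (s t : R) :
    (forall i (s t : R), s \in `[0, 1] -> t \in `[0, 1] ->
      `|f i s - f i t| <= L * `|s - t|) ->
    s \in `[0, 1] -> t \in `[0, 1] -> piece s = piece t ->
    f i s = pt p -> f i t = pt q ->
    (inord (p %% d.+1) : 'I_d.+1) = inord (q %% d.+1) -> p = q.
  move=> fL s01 t01 st fp fq /(congr1 val)/=; rewrite !inordK ?ltn_pmod// => pq.
  have pqd : `|p%:R - q%:R| <= `|L| / eta :> R.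
    rewrite ler_pdivlMr// -(ler_pM2r M0); have := fL i s t s01 t01.
    have -> : f i s - f i t = (p%:R - q%:R) * eta / M%:R.
      by rewrite fp fq /pt; field; rewrite gt_eqF.
    rewrite normrM normfV (gtr0_norm M0) normrM (gtr0_norm eta0).
    rewrite ler_pdivrMr// => h.
    have h1 : `|p%:R - q%:R| * eta <= `|L|.
      rewrite (le_trans h)// -mulrA (le_trans (ler_norm _))// normrM.
      by rewrite ler_piMr// ger0_norm ?mulr_ge0 ?(ltW M0)// pieceP.
    by rewrite ler_pM2r.
  have le_d (a b : nat) : (a <= b)%N -> `|a%:R - b%:R| <= `|L| / eta ->
      (b - a <= d)%N.
    move=> ab; rewrite distrC ger0_norm ?subr_ge0 ?ler_nat// -natrB// => h.
    by rewrite truncn_ge_nat// divr_ge0// ltW.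
  apply/val_inj => /=; have [pq'|qp'] := leqP p q.
    by apply: (@eq_mod_close _ _ d) => //; exact: le_d.
  apply/esym; apply: (@eq_mod_close _ _ d) => //; first exact: ltnW.
  by apply: le_d; [exact: ltnW|rewrite distrC].
have code_inj : injective code.
  move=> [p q] [p' q'] [Fi Fs ep eq].
  have [s01 /= s1 s2] := FP (p, q); have [t01 /= t1 t2] := FP (p', q').
  rewrite -Fi in t1 t2.
  by rewrite (close _ _ _ _ _ _ f1L s01 t01 Fs s1 t1 ep)
    (close _ _ _ _ _ _ f2L s01 t01 Fs s2 t2 eq).
have := leq_card _ code_inj; rewrite !card_prod !card_ord.
rewrite mulnAC -/K leqNgt => /negP; apply.
rewrite /M; lia.
Qed.

End avoidance.

Section perturbation.
Variables (R : realType) (G : graph).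
Implicit Type g : loop R G.

(** The loops that avoid the set of codimension two where two energies coincide
    and two barriers coincide. *)
Definition generic_loop g := forall t : R, t \in `[0, 1] ->
  injective (fun i => (g t).1 0 i) \/ injective (fun a => (g t).2 0 a).

(** It suffices to translate the loop by a vector proportional to
    [(0, 1, 2, ...)] in the energies and in the barriers: a translation by
    [(u, v)] fails exactly if [(u, v)] lies on one of the curves of normalized
    differences of energies and of barriers. *)
Lemma generic_perturbation g k (e : R) : 0 < e ->
  exists2 g1 : loop R G, generic_loop g1 & Ck_ball g k e g1.
Proof.
move=> e0; pose N := ((nvertices G + nedges G).+1)%:R : R.
have N0 : 0 < N by rewrite ltr0n.
pose f1 (q : ('I_(nvertices G) * 'I_(nvertices G)) * ('I_(nedges G) * 'I_(nedges G)))
  (t : R) : R := ((g t).1 0 q.1.1 - (g t).1 0 q.1.2) / (q.1.2%:R - q.1.1%:R).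
pose f2 (q : ('I_(nvertices G) * 'I_(nvertices G)) * ('I_(nedges G) * 'I_(nedges G)))
  (t : R) : R := ((g t).2 0 q.2.1 - (g t).2 0 q.2.2) / (q.2.2%:R - q.2.1%:R).
have [L [f1L f2L]] : exists L : R,
    (forall q (s t : R), s \in `[0, 1] -> t \in `[0, 1] ->
      `|f1 q s - f1 q t| <= L * `|s - t|) /\
    (forall q (s t : R), s \in `[0, 1] -> t \in `[0, 1] ->
      `|f2 q s - f2 q t| <= L * `|s - t|).
  have [L1 L1P] := @finite_lipschitz R _ f1 (fun q =>
    C1funM (C1funB (C1fun_energy g q.1.1) (C1fun_energy g q.1.2)) (C1fun_cst _)).
  have [L2 L2P] := @finite_lipschitz R _ f2 (fun q =>
    C1funM (C1funB (C1fun_barrier g q.2.1) (C1fun_barrier g q.2.2)) (C1fun_cst _)).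
  exists (Num.max L1 L2); split=> q s t s0 t0.
    by apply: le_trans (L1P q s t s0 t0) _; rewrite ler_wpM2r// le_max lexx.
  by apply: le_trans (L2P q s t s0 t0) _; rewrite ler_wpM2r// le_max lexx orbT.
have eta0 : 0 < e / (2 * N) by rewrite divr_gt0// mulr_gt0.
have [u [v [uI vI uv]]] := curves_avoid_point eta0 f1L f2L.
pose x : params R G := (\row_i (u * i%:R), \row_a (v * a%:R)).
exists (translate_loop g x); last first.
  apply: translate_loop_Ck_ball.
  have small (w : R) (i : nat) : 0 <= w <= e / (2 * N) ->
      (i <= nvertices G + nedges G)%N -> `|w * i%:R| <= e / 2.
    move=> /andP[w0 wE] iN; rewrite ger0_norm ?mulr_ge0//.
    have -> : e / 2 = e / (2 * N) * N by field; rewrite gt_eqF.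
    by rewrite ler_pM// ler_nat (leq_trans iN).
  apply: (@le_lt_trans _ _ (e / 2)); last lra.
  have e2 : 0 <= e / 2 by lra.
  rewrite prod_normE ge_max; apply/andP; split.
    rewrite [leLHS]/Num.Def.normr/= mx_normrE bigmax_le// => -[i j] _.
    by rewrite mxE small// ltnW// ltn_addr.
  rewrite [leLHS]/Num.Def.normr/= mx_normrE bigmax_le// => -[i j] _.
  by rewrite mxE small// ltnW// ltn_addl.
move=> t t01; apply: contrapT => /not_orP[nE nW].
have [i [j [ij Eij]]] : exists i j, i <> j /\
    (translate_loop g x t).1 0 i = (translate_loop g x t).1 0 j.
  apply: contrapT => h; apply: nE => i j Eij; apply: contrapT => ij.
  by apply: h; exists i, j.
have [a [c [ac Wac]]] : exists a c, a <> c /\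
    (translate_loop g x t).2 0 a = (translate_loop g x t).2 0 c.
  apply: contrapT => h; apply: nW => a c Wac; apply: contrapT => ac.
  by apply: h; exists a, c.
have neq0 l (p q : 'I_l) : p <> q -> q%:R - p%:R != 0 :> R.
  by move=> pq; rewrite subr_eq0 eqr_nat; apply/eqP => /val_inj /esym.
apply: (uv ((i, j), (a, c)) t t01).
  apply: (mulIf (neq0 _ _ _ ij)); rewrite divfK ?neq0//=.
  by move: Eij; rewrite /= !mxE; lra.
apply: (mulIf (neq0 _ _ _ ac)); rewrite divfK ?neq0//=.
by move: Wac; rewrite /= !mxE; lra.
Qed.

End perturbation.

(** * The adiabatic limit *)

Section regularity_along_loops.
Variables (R : realType) (G : graph).
Hypothesis cG : connected_graph G.
Variables (b : R) (g : loop R G).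
Local Notation n := (nvertices G).
Local Notation m := (nedges G).
Local Notation D := (@boundary R G).

Lemma C1fun_weight (h : R -> R) : C1fun h -> C1fun (fun t => expR (b * h t)).
Proof. by move=> hC; apply/C1fun_expR/C1funM => //; exact: C1fun_cst. Qed.

Lemma C1fun_weightN (h : R -> R) : C1fun h ->
  C1fun (fun t => expR (- (b * h t))).
Proof.
by move=> hC; apply/C1fun_expR/C1funN/C1funM => //; exact: C1fun_cst.
Qed.

Lemma C1fun_flux a i : C1fun (fun t => flux b (g t) a i).
Proof.
under eq_fun do rewrite flux_entry.
apply: C1funM; last exact: C1fun_weight (C1fun_energy g i).
apply: C1funM; last exact: C1fun_cst.
exact: C1fun_weightN (C1fun_barrier g a).
Qed.

Lemma C1fun_master i j : C1fun (fun t => master b (g t) i j).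
Proof.
under eq_fun do rewrite /master mxE; apply: C1funN.
apply: (@C1fun_mulmx _ _ _ _ (fun=> D)) => [? ?|]; first exact: C1fun_cst.
exact: C1fun_flux.
Qed.

(** The time derivative of the Boltzmann distribution along [g]. *)
Definition boltzmann_rate (t : R) : C0 R G := \col_i
  (- b * boltzmann b (g t) i 0 * ((derive1n 1 g t).1 0 i -
     \sum_j boltzmann b (g t) j 0 * (derive1n 1 g t).1 0 j)).

Lemma is_derive_boltzmann (t : R) i :
  is_derive t 1 (fun s => boltzmann b (g s) i 0) (boltzmann_rate t i 0).
Proof.
pose e j (s : R) := expR (- (b * (g s).1 0 j)).
have ed j : is_derive t 1 (e j) (e j t * (- (b * (derive1n 1 g t).1 0 j))).
  apply: (@is_derive1_comp _ expR (fun s => - (b * (g s).1 0 j))).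
  apply: is_deriveN; apply: is_deriveZ; exact: is_derive_energy.
pose Z := fun s => \sum_j e j s.
have Zd : is_derive t 1 Z (\sum_j e j t * (- (b * (derive1n 1 g t).1 0 j))).
  by apply: is_derive_bigsum => j _; exact: ed.
have Z0 : Z t != 0 by rewrite gt_eqF// (partition_function_gt0 cG).
under eq_fun do rewrite mxE.
apply: is_derive_eq (is_deriveM (ed i) (is_deriveV Z0 Zd)) _.
rewrite /= !mxE.
under [in RHS]eq_bigr do rewrite mxE.
have -> : \sum_j e j t * - (b * (derive1n 1 g t).1 0 j) =
    - (b * \sum_j e j t * (derive1n 1 g t).1 0 j).
  rewrite mulr_sumr -sumrN; apply: eq_bigr => j _.
  by rewrite mulrN mulrCA.
rewrite -/(Z t) -/(e i t) /partition_function -/(Z t).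
under [in RHS]eq_bigr => j _ do rewrite -/(e j t) mulrAC.
rewrite -mulr_suml /GRing.scale/=.
set S := \sum_j _; by field.
Qed.

Lemma C1fun_boltzmann i : C1fun (fun t => boltzmann b (g t) i 0).
Proof.
under eq_fun do rewrite mxE; apply: C1funM.
  exact: C1fun_weightN (C1fun_energy g i).
apply: C1funV => [t|]; first by rewrite gt_eqF// (partition_function_gt0 cG).
by apply: C1fun_sum => j; exact: C1fun_weightN (C1fun_energy g j).
Qed.

Lemma continuous_boltzmann_rate i : continuous (fun t => boltzmann_rate t i 0).
Proof.
have cE j := @continuous_velocity R G g j.
have cB j := C1fun_continuous (C1fun_boltzmann j).
under eq_fun do rewrite mxE; apply: continuous_mulr.
  by apply: continuous_mulr => // t; exact: cvg_cst.
have cS : continuous (fun t => \sum_j boltzmann b (g t) j 0 * (derive1n 1 g t).1 0 j).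
  by apply: continuous_bigsum => j; exact: continuous_mulr.
by move=> t; apply: cvgB; [exact: cE|exact: cS].
Qed.

Lemma sum_boltzmann_rate (t : R) : \sum_i boltzmann_rate t i 0 = 0.
Proof.
under eq_bigr do rewrite mxE -mulrA mulrBr.
rewrite -mulr_sumr sumrB -mulr_suml sum_boltzmann// mul1r subrr mulr0 //.
Qed.

Lemma C1fun_response a i : C1fun (fun t => response b (g t) a i).
Proof.
apply: C1fun_mulmx; first exact: C1fun_flux.
apply: C1fun_invmx => [t|k l]; first exact: regular_master_unit.
have e t : regular_master b (g t) k l = master b (g t) k l + boltzmann b (g t) k 0.
  by rewrite mxE; congr (_ + _); rewrite mxE big_ord1 [X in _ * X]mxE mulr1.
under eq_fun do rewrite e.
by apply: C1funD; [exact: C1fun_master|exact: C1fun_boltzmann].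
Qed.

End regularity_along_loops.

Section dissipative_decay.
Variables (R : realType) (G : graph).
Hypothesis cG : connected_graph G.
Variables (b : R) (g : loop R G).
Local Notation n := (nvertices G).
Local Notation m := (nedges G).
Local Notation D := (@boundary R G).

(** At a maximum of the energy [\sum_i expR (b * E_i) * dl_i ^ 2], which by
    periodicity can be taken at a positive time, the energy does not decrease;
    so the dissipation, which is comparable to [tau] times the energy, is
    bounded by the forcing [r] and by the variation of the weights. The latter
    is absorbed for [tau] large. *)
Lemma periodic_decay : exists C T : R, [/\ 0 <= C, 0 < T &
  forall tau : R, T <= tau -> forall (dl r : R -> C0 R G) (c : R), 0 <= c ->
  (forall t : R, t \in `[0, 1] -> \sum_i dl t i 0 = 0) ->
  (forall t : R, t \in `[0, 1] -> forall i, is_derive t 1 (fun s => dl s i 0)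
     (tau * (master b (g t) *m dl t) i 0 - r t i 0)) ->
  (forall t : R, t \in `[0, 1] -> forall i, `|r t i 0| <= c) ->
  dl 0 = dl 1 ->
  forall t : R, t \in `[0, 1] -> forall i, `|dl t i 0| <= C * c / tau].
Proof.
have kC i := C1fun_weight b (C1fun_energy g i).
have [k' k'P] := choice (fun i => let: ex_intro2 k' ck kd := kC i in
  ex_intro (fun k' : R -> R => continuous k' /\ forall t : R,
    is_derive t 1 (fun t => expR (b * (g t).1 0 i)) (k' t)) k' (conj ck kd)).
have [M1 M10 k'M] := finite_continuous_bounded (fun i => (k'P i).1).
have [M0 [M00 kM]] := @finite_weight_bounds R _ (fun i t => b * (g t).1 0 i)
  (fun i => C1funM (C1fun_cst b) (C1fun_energy g i)).
have [W0 [W00 wM]] := @finite_weight_bounds R _ (fun a t => - (b * (g t).2 0 a))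
  (fun a => C1funN (C1funM (C1fun_cst b) (C1fun_barrier g a))).
pose N : R := n%:R.
have N0 : 0 < N by rewrite ltr0n; have [] := cG.
(* With [s] the maximum of [`|dl|] at the maximal energy, the comparison of
   dissipation and forcing reads [tau * A * s ^ 2 <= B * s ^ 2 + Cf * s * c], and
   [X * s] bounds [`|dl|] at all times. *)
pose A : R := 2 / (M0 ^+ 2 * W0).
pose B := N ^+ 3 * M1; pose Cf := 2 * N ^+ 3 * M0.
pose X := N * M0 ^+ 2 + 1.
have A0 : 0 < A by rewrite divr_gt0// mulr_gt0// exprn_gt0.
have B0 : 0 <= B by rewrite mulr_ge0// exprn_ge0// ltW.
have Cf0 : 0 <= Cf by rewrite !mulr_ge0// ?exprn_ge0// ltW.
have NM0 : 0 <= N * M0 ^+ 2 by rewrite mulr_ge0 ?sqr_ge0// ltW.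
have X0 : 0 <= X by rewrite addr_ge0.
have CfA : 0 <= 2 * Cf / A by apply: divr_ge0; [exact: mulr_ge0|exact: ltW].
have BA0 : 0 <= 2 * B / A by apply: divr_ge0; [exact: mulr_ge0|exact: ltW].
exists (X * (2 * Cf / A)), (2 * B / A + 1); split.
- exact: mulr_ge0.
- by rewrite ltr_wpDl.
move=> tau Ttau dl r c c0 dl0 dld rc dl01.
have tau0 : 0 < tau.
  by apply: lt_le_trans Ttau; rewrite ltr_wpDl.
have BA : 2 * B <= tau * A.
  rewrite -ler_pdivrMr//; apply: le_trans Ttau; rewrite lerDl//.
pose k i (t : R) := expR (b * (g t).1 0 i).
pose V (t : R) := \sum_i k i t * dl t i 0 ^+ 2.
pose V' (t : R) := \sum_i (k i t * (2 * dl t i 0 *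
    (tau * (master b (g t) *m dl t) i 0 - r t i 0)) + dl t i 0 ^+ 2 * k' i t).
have Vd (t : R) : t \in `[0, 1] -> is_derive t 1 V (V' t).
  move=> t01; apply: is_derive_bigsum => i _.
  have d2 : is_derive t 1 (fun s => dl s i 0 * dl s i 0) _ :=
    is_deriveM (dld t t01 i) (dld t t01 i).
  under eq_fun do rewrite expr2.
  apply: is_derive_eq (is_deriveM ((k'P i).2 t) d2) _.
  rewrite /GRing.scale/= /k; ring.
(* The maximum is attained at a time that can be approached from the left. *)
have [t1 t1I t1M] : exists2 t1, t1 \in `]0, 1] &
    forall t : R, t \in `[0, 1] -> V t <= V t1.
  have [t1 + t1M] := EVT_max (ler01 : (0 : R) <= 1) (is_derive_continuous_within Vd).
  rewrite in_itv/= => /andP[]; rewrite le_eqVlt => /predU1P[t10 _|t10 t11].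
    exists 1; rewrite ?in_itv/= ?ltr01 ?lexx// => t /t1M.
    by rewrite -t10 /V dl01 /k loop_one_zero.
  by exists t1 => //; rewrite in_itv/= t10.
have t1I' : t1 \in `[0, 1] by apply: subset_itv_oc_cc t1I.
have V'0 : 0 <= V' t1.
  move: (t1I); rewrite in_itv/= => /andP[t10 t11].
  apply: (ge0_derive_left_max t10 (Vd _ t1I')) => s /andP[s0 st].
  by apply: t1M; rewrite in_itv/= s0 (le_trans st).
pose Q := \sum_a expR (- (b * (g t1).2 0 a)) *
  (k (d0 a) t1 * dl t1 (d0 a) 0 - k (d1 a) t1 * dl t1 (d1 a) 0) ^+ 2.
have Qdiss : 2 * tau * Q <= \sum_i (dl t1 i 0 ^+ 2 * k' i t1 -
    2 * k i t1 * dl t1 i 0 * r t1 i 0).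
  rewrite -subr_ge0; apply: le_trans V'0 _; rewrite le_eqVlt; apply/orP; left.
  apply/eqP; have := dissipation b (g t1) (dl t1); rewrite -/Q => /(congr1 -%R).
  rewrite opprK => <-; rewrite mulrN opprK mulr_sumr -big_split/=.
  by apply: eq_bigr => i _; rewrite /k; ring.
have Q0 : 0 <= Q.
  by apply: sumr_ge0 => a _; rewrite mulr_ge0 ?expR_ge0 ?sqr_ge0.
pose s := \big[Num.max/0]_i `|dl t1 i 0|.
have sP i : `|dl t1 i 0| <= s by exact: le_bigmax.
have s0 : 0 <= s.
  by rewrite /s; elim/big_ind: _ => // u v u0 v0; rewrite le_max u0.
have sQ : s ^+ 2 <= N ^+ 2 * Q * (M0 ^+ 2 * W0).
  pose e := Num.sqrt (Q * W0).
  have e0 : 0 <= e by exact: sqrtr_ge0.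
  have e2 : e ^+ 2 = Q * W0 by rewrite sqr_sqrtr// mulr_ge0// ltW.
  have edge (a : 'I_m) : `|k (d0 a) t1 * dl t1 (d0 a) 0 -
      k (d1 a) t1 * dl t1 (d1 a) 0| <= e.
    rewrite -ler_sqr ?nnegrE// real_normK ?num_real// e2.
    rewrite -ler_pdivrMr//; have /andP[wa _] := wM a t1 t1I'.
    apply: (@le_trans _ _ (expR (- (b * (g t1).2 0 a)) *
      (k (d0 a) t1 * dl t1 (d0 a) 0 - k (d1 a) t1 * dl t1 (d1 a) 0) ^+ 2)).
      by rewrite mulrC ler_wpM2r ?sqr_ge0.
    rewrite /Q (bigD1 a)//= lerDl; apply: sumr_ge0 => a' _.
    by rewrite mulr_ge0 ?expR_ge0 ?sqr_ge0.
  have pot := le_potential (k := fun i => k i t1) cG e0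
    (fun i => expR_gt0 _) (dl0 t1 t1I') edge.
  have sNe : s <= M0 * (N * e).
    apply: bigmax_le => [|i _]; first by rewrite !mulr_ge0// ltW.
    have /andP[ki _] := kM i t1 t1I'.
    rewrite -ler_pdivrMl// (le_trans _ (pot i))// ler_wpM2r//.
  have : s ^+ 2 <= (M0 * (N * e)) ^+ 2.
    by rewrite ler_sqr ?nnegrE// (le_trans s0).
  rewrite !exprMn e2 => /le_trans; apply.
  by rewrite le_eqVlt; apply/orP; left; apply/eqP; ring.
have rhs : 2 * tau * Q <= N * (M1 * s ^+ 2 + 2 * M0 * s * c).
  apply: (le_trans Qdiss); apply: ler_sum_ord => i; apply: (le_trans (ler_norm _)).
  apply: (le_trans (ler_normB _ _)); apply: lerD.
    rewrite normrM mulrC ler_pM//; first exact: k'M.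
    by rewrite normrX ler_sqr ?nnegrE.
  have /andP[_ kiM] := kM i t1 t1I'.
  rewrite !normrM (ger0_norm (_ : 0 <= 2))// (ger0_norm (expR_ge0 _)).
  rewrite ler_pM ?mulr_ge0 ?expR_ge0//; last exact: rc.
  by rewrite ler_pM ?mulr_ge0 ?expR_ge0// ler_wpM2l.
have small : s <= 2 * Cf / A * c / tau.
  have [<-|sn0] := eqVneq 0 s.
    by apply: divr_ge0; [exact: mulr_ge0|exact: ltW].
  have sp : 0 < s by rewrite lt_neqAle sn0.
  have P0 : 0 < M0 ^+ 2 * W0 by rewrite mulr_gt0// exprn_gt0.
  have h1 : A * s ^+ 2 <= 2 * N ^+ 2 * Q.
    rewrite /A -ler_pdivlMl ?divr_gt0// (le_trans sQ)// le_eqVlt; apply/orP; left.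
    by apply/eqP; field; rewrite !gt_eqF.
  have h2 : tau * A * s ^+ 2 <= B * s ^+ 2 + Cf * s * c.
    have := ler_wpM2l (ltW tau0) h1.
    have := ler_wpM2l (sqr_ge0 N) rhs.
    rewrite /B /Cf; move=> u1 u2; rewrite -mulrA (le_trans u2)//.
    have -> : tau * (2 * N ^+ 2 * Q) = N ^+ 2 * (2 * tau * Q) by ring.
    by rewrite (le_trans u1)// le_eqVlt; apply/orP; left; apply/eqP; ring.
  have h3 : 2 * B * s ^+ 2 <= tau * A * s ^+ 2 by rewrite ler_wpM2r ?sqr_ge0.
  have h4 : (tau * A * s) * s <= (2 * Cf * c) * s.
    have -> : (tau * A * s) * s = tau * A * s ^+ 2 by ring.
    have -> : (2 * Cf * c) * s = 2 * (Cf * s * c) by ring.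
    by move: h2 h3; rewrite -mulrA; lra.
  rewrite ler_pdivlMr// mulrAC ler_pdivlMr//.
  by move: h4; rewrite ler_pM2r// mulrC mulrA [s * tau]mulrC mulrAC.
move=> t t01 i.
have Xs : `|dl t i 0| <= X * s.
  rewrite -ler_sqr ?nnegrE ?mulr_ge0// real_normK ?num_real//.
  have kdl : dl t i 0 ^+ 2 <= M0 * V t.
    have /andP[kl _] := kM i t t01.
    rewrite -ler_pdivrMl//; apply: (@le_trans _ _ (k i t * dl t i 0 ^+ 2)).
      by rewrite ler_wpM2r ?sqr_ge0.
    rewrite /V (bigD1 i)//= lerDl; apply: sumr_ge0 => j _.
    by rewrite mulr_ge0 ?expR_ge0 ?sqr_ge0.
  have Vt1 : V t1 <= N * (M0 * s ^+ 2).
    apply: ler_sum_ord => j; have /andP[_ kl] := kM j t1 t1I'.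
    rewrite ler_pM ?expR_ge0 ?sqr_ge0// -[leLHS]ger0_norm ?sqr_ge0// normrX.
    by rewrite ler_sqr ?nnegrE.
  rewrite (le_trans kdl)// (le_trans (ler_wpM2l (ltW M00) (t1M t t01)))//.
  rewrite (le_trans (ler_wpM2l (ltW M00) Vt1))// exprMn.
  have -> : M0 * (N * (M0 * s ^+ 2)) = (N * M0 ^+ 2) * s ^+ 2 by ring.
  rewrite ler_wpM2r ?sqr_ge0// /X.
  by have := sqr_ge0 (N * M0 ^+ 2); move: NM0; lra.
rewrite (le_trans Xs)// -!mulrA ler_wpM2l//.
by move: small; rewrite -!mulrA.
Qed.

End dissipative_decay.

Section periodic_solutions.
Variables (R : realType) (G : graph).
Hypothesis cG : connected_graph G.
Variables (b : R) (g : loop R G).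
Local Notation n := (nvertices G).
Local Notation m := (nedges G).
Local Notation D := (@boundary R G).

Lemma master_bounded : exists M : R,
  forall (t : R) i j, `|master b (g t) i j| <= M.
Proof.
have [M _ MP] := @finite_continuous_bounded R _ (fun ij t => master b (g t) ij.1 ij.2)
  (fun ij => C1fun_continuous (C1fun_master b g ij.1 ij.2)).
exists M => t i j; have [s s01 ->] := loop_reduce g t.
exact: MP (i, j) _ s01.
Qed.

(** The monodromy matrix preserves the total probability, hence has a fixed
    vector; its total probability is not 0 since periodic solutions of zero sum
    vanish by [periodic_decay]. The same lemma, applied to differences, gives
    uniqueness and the distance to the Boltzmann distribution. *)
Lemma ex_periodic_solution : exists C T : R, [/\ 0 <= C, 0 < T &
  forall tau : R, T <= tau -> exists rho : R -> C0 R G,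
  [/\ forall (t : R) i, is_derive t 1 (fun s => rho s i 0)
        (tau * (master b (g t) *m rho t) i 0),
      unique_periodic_solution b tau g rho,
      forall t : R, \sum_i rho t i 0 = 1 &
      forall t : R, t \in `[0, 1] -> forall i,
        `|rho t i 0 - boltzmann b (g t) i 0| <= C / tau]].
Proof.
have [C [T [Cge0 T0 decay]]] := periodic_decay cG b g.
have [c c0 rate_c] := @finite_continuous_bounded R _
  (fun i t => boltzmann_rate b g t i 0) (@continuous_boltzmann_rate R G cG b g).
exists (C * c), T; split => //; first exact: mulr_ge0.
move=> tau Ttau; have [M MP] := master_bounded.
pose A t := tau *: master b (g t).
have cA i j : continuous (fun t => A t i j).
  apply: C1fun_continuous; under eq_fun do rewrite mxE.
  by apply: C1funM; [exact: C1fun_cst|exact: C1fun_master].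
have bA t i j : `|A t i j| <= `|tau| * M.
  by rewrite mxE normrM ler_wpM2l.
have [U [U0 Ud]] := linear_equation_solution 1%:M cA bA.
have U1 (t : R) : const_mx 1 *m U t = const_mx 1 :> 'rV_n.
  apply/rowP => j.
  have d (s : R) : is_derive s 1 (fun s => \sum_i U s i j) 0.
    have := is_derive_bigsum (index_enum 'I_n) (P := xpredT) (t := s)
      (fun i _ => Ud s i j).
    move=> /is_derive_eq; apply.
    by rewrite -mul_row1E mulmxA -scalemxAr row1_master scaler0 mul0mx mxE.
  by rewrite mul_row1E (is_derive_0_is_cst t 0 d) U0 -mul_row1E mulmx1.
have [x x0 Ux] := column_stochastic_fixpoint cG.1 (U1 1).
have Uxd (t : R) i : is_derive t 1 (fun s => (U s *m x) i 0)
    (tau * (master b (g t) *m (U t *m x)) i 0).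
  apply: is_derive_eq (is_derive_mulmx_col x (Ud t) i) _.
  by rewrite -mulmxA -scalemxAl mxE.
have sumU t : \sum_i (U t *m x) i 0 = \sum_i x i 0.
  by rewrite -!mul_row1E mulmxA U1.
have x1 : \sum_i x i 0 != 0.
  apply: contra x0 => /eqP x0; apply/eqP.
  have h : forall t : R, t \in `[0, 1] -> forall i, `|(U t *m x) i 0| <= C * 0 / tau.
    apply: (decay tau Ttau (fun t => U t *m x) (fun=> 0)) => //.
    - by move=> t _; rewrite sumU.
    - move=> t _ i; apply: is_derive_eq (Uxd t i) _.
      by rewrite [X in _ = _ - X]mxE subr0.
    - by move=> t _ i; rewrite mxE normr0.
    - by rewrite U0 mul1mx Ux.
  apply/colP => i; have := h 0 _ i; rewrite U0 mul1mx mulr0 mul0r mxE in_itv/=.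
  by rewrite lexx ler01 normr_le0 => /(_ isT)/eqP.
pose rho t : C0 R G := U t *m ((\sum_i x i 0)^-1 *: x).
have rhod (t : R) i : is_derive t 1 (fun s => rho s i 0)
    (tau * (master b (g t) *m rho t) i 0).
  apply: is_derive_eq (is_derive_mulmx_col _ (Ud t) i) _.
  by rewrite -mulmxA -scalemxAl mxE.
have rho1 (t : R) : \sum_i rho t i 0 = 1.
  rewrite /rho -scalemxAr; under eq_bigr do rewrite mxE.
  by rewrite -mulr_sumr sumU mulVf.
have rho01 : rho 0 = rho 1 by rewrite /rho U0 mul1mx -scalemxAr Ux.
exists rho; split=> //.
  split.
    split=> //; first by move=> t _; exact: rho1.
    move=> t _; suff h : is_derive t 1 rho (tau *: (master b (g t) *m rho t)).
      exact: h.
    by apply: is_derive_mx => i j; rewrite ord1 mxE; exact: rhod.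
  move=> rho' [sum' d' per'] t t01.
  have h : forall t : R, t \in `[0, 1] -> forall i,
      `|(rho' t - rho t) i 0| <= C * 0 / tau.
    apply: (decay tau Ttau (fun t => rho' t - rho t) (fun=> 0)) => //.
    - move=> s s01; have := sum' s s01; rewrite /barC0/= => e.
      under eq_bigr do rewrite mxE [X in _ + X]mxE.
      by rewrite sumrB rho1 e subrr.
    - move=> s s01 i; have ds : is_derive s 1 rho' (tau *: (master b (g s) *m rho' s)).
        exact: d' s s01.
      have := is_deriveB (is_derive_entry i 0 ds) (rhod s i).
      have -> : ((fun s => rho' s i 0) - (fun s => rho s i 0)) =
          (fun s => (rho' s - rho s) i 0).
        by apply/funext => u; rewrite [RHS]mxE [X in _ = _ + X]mxE.
      move=> /is_derive_eq; apply; rewrite mulmxBr !mxE; ring.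
    - by move=> s _ i; rewrite mxE normr0.
    - by rewrite rho01 per'.
  apply/colP => i; have := h t t01 i; rewrite mulr0 mul0r normr_le0 2!mxE.
  by rewrite subr_eq0 => /eqP.
suff h : forall t : R, t \in `[0, 1] -> forall i,
    `|(rho t - boltzmann b (g t)) i 0| <= C * c / tau.
  by move=> t t01 i; have := h t t01 i; rewrite mxE [X in _ + X]mxE.
apply: (decay tau Ttau (fun t => rho t - boltzmann b (g t)) (boltzmann_rate b g)) => //.
- move=> t t01; under eq_bigr do rewrite mxE [X in _ + X]mxE.
  by rewrite sumrB rho1 sum_boltzmann// subrr.
- move=> t t01 i; have := is_deriveB (rhod t i) (is_derive_boltzmann cG b g t i).
  have -> : ((fun s => rho s i 0) - (fun s => boltzmann b (g s) i 0)) =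
      (fun s => (rho s - boltzmann b (g s)) i 0).
    by apply/funext => u; rewrite [RHS]mxE [X in _ = _ + X]mxE.
  move=> /is_derive_eq; apply.
  rewrite mulmxBr [master _ _ *m boltzmann _ _]masterE flux_boltzmann//.
  by rewrite mulmx0 oppr0 subr0.
- by move=> t t01 i; exact: rate_c.
- by rewrite rho01 loop_one_zero.
Qed.

End periodic_solutions.

Section adiabatic_currents.
Variables (R : realType) (G : graph).
Hypothesis cG : connected_graph G.
Variables (b : R) (g : loop R G).
Local Notation n := (nvertices G).
Local Notation m := (nedges G).
Local Notation D := (@boundary R G).

Definition adiabatic_density a (t : R) : R :=
  (response b (g t) *m boltzmann_rate b g t) a 0.

Definition adiabatic_current : C1 R G :=
  \col_a (primitive (adiabatic_density a) 1 - primitive (adiabatic_density a) 0).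

Lemma continuous_adiabatic_density a : continuous (adiabatic_density a).
Proof.
apply: continuous_mulmx => [i j|i j].
  exact: C1fun_continuous (C1fun_response cG b g i j).
by rewrite ord1; exact: continuous_boltzmann_rate.
Qed.

(** The current is the response to the time derivative of the periodic solution.
    Integration by parts replaces this derivative, about which nothing is known
    for large [tau], by the solution itself, which is close to the Boltzmann
    distribution. *)
Lemma adiabatic_limit : is_adiabatic_current b g adiabatic_current.
Proof.
have [C [T [Cge0 T0 sol]]] := ex_periodic_solution cG b g.
have [B' B'P] := choice (fun ai : 'I_m * 'I_n =>
  let: ex_intro2 f cf fd := C1fun_response cG b g ai.1 ai.2 in
  ex_intro (fun f : R -> R => continuous f /\ forall t : R,
    is_derive t 1 (fun t => response b (g t) ai.1 ai.2) (f t)) f (conj cf fd)).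
have [M M0 B'M] := @finite_continuous_bounded R _ B' (fun ai => (B'P ai).1).
pose K := n%:R * (M * C).
have main tau : exists q : C1 R G, T <= tau -> is_average_current b tau g q /\
    forall a, `|adiabatic_current a 0 - q a 0| <= K / tau.
  have [Ttau|] := leP T tau; last by exists 0.
  have tau0 : 0 < tau by apply: lt_le_trans Ttau.
  have [rho [rhod rhoU rho1 rhoC]] := sol tau Ttau.
  exists (integrated_current b tau g rho) => _; split; first by exists rho.
  move=> a; pose J (t : R) : R := current b tau g rho t a 0.
  pose dl t := rho t - boltzmann b (g t).
  have sumdl t : \sum_i dl t i 0 = 0.
    under eq_bigr do rewrite mxE [X in _ + X]mxE.
    by rewrite sumrB rho1 sum_boltzmann// subrr.
  have JE t : J t = tau * (flux b (g t) *m rho t) a 0 by rewrite /J /current mxE.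
  have Jresp t : J t = (response b (g t) *m (tau *: (master b (g t) *m rho t))) a 0.
    have flux_dl : flux b (g t) *m rho t = flux b (g t) *m dl t.
      by rewrite mulmxBr flux_boltzmann// subr0.
    have master_dl : master b (g t) *m rho t = master b (g t) *m dl t.
      by rewrite !masterE flux_dl.
    by rewrite JE flux_dl master_dl -scalemxAr response_master// [RHS]mxE.
  have cJ : continuous J.
    have -> : J = fun t => tau * (flux b (g t) *m rho t) a 0.
      by apply/funext => t; rewrite JE.
    apply: continuous_mulr; first by move=> t; exact: cvg_cst.
    apply: continuous_mulmx => i j.
      exact: C1fun_continuous (C1fun_flux b g i j).
    by rewrite ord1 => t; exact: is_derive1_continuous (rhod t i).
  have intJ : integrated_current b tau g rho a 0 = primitive J 1 - primitive J 0.
    rewrite mxE; apply: integral_derivative => // [t _|].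
      exact: is_derive_primitive.
    exact: continuous_subspaceT.
  have dld (t : R) i : is_derive t 1 (fun s => rho s i 0 - boltzmann b (g s) i 0)
      (tau * (master b (g t) *m rho t) i 0 - boltzmann_rate b g t i 0).
    exact: is_deriveB (rhod t i) (is_derive_boltzmann cG b g t i).
  pose F s := \sum_i response b (g s) a i * (rho s i 0 - boltzmann b (g s) i 0).
  pose F' s := \sum_i (response b (g s) a i *
    (tau * (master b (g s) *m rho s) i 0 - boltzmann_rate b g s i 0) +
    (rho s i 0 - boltzmann b (g s) i 0) * B' (a, i) s).
  have Fd (t : R) : is_derive t 1 F (F' t).
    apply: is_derive_bigsum => i _.
    exact: is_deriveM ((B'P (a, i)).2 t) (dld t i).
  (* [F] collects the boundary terms of the integration by parts. *)
  pose P s := primitive J s - primitive (adiabatic_density a) s - F s.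
  have Pd (t : R) : is_derive t 1 P (J t - adiabatic_density a t - F' t).
    apply: is_deriveB (Fd t).
    exact: is_deriveB (is_derive_primitive t cJ)
      (is_derive_primitive t (@continuous_adiabatic_density a)).
  have P'E t : J t - adiabatic_density a t - F' t =
      - \sum_i (rho t i 0 - boltzmann b (g t) i 0) * B' (a, i) t.
    rewrite Jresp /adiabatic_density /F' big_split/= opprD addrA.
    rewrite [X in X + _](_ : _ = 0) ?add0r// !mxE -!sumrB big1// => i _.
    have -> (x : C0 R G) : (tau *: x) i 0 = tau * x i 0 by rewrite mxE.
    ring.
  have : `|P 1 - P 0| <= K / tau * (1 - 0).
    apply: (le_increment ler01 (fun t _ => Pd t)) => t t01.
    rewrite P'E normrN (le_trans (ler_norm_sum _ _ _))// /K -mulrA.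
    apply: ler_sum_ord => i; rewrite normrM mulrC -mulrA ler_pM//; first exact: B'M.
    exact: rhoC.
  have F10 : F 1 = F 0.
    have [_ _ rho01] := rhoU.1.
    by rewrite /F loop_one_zero rho01.
  rewrite subr0 mulr1 distrC [adiabatic_current _ _]mxE intJ /P F10.
  set u := primitive J 1; set v := primitive J 0.
  set w := primitive _ 1; set z := primitive _ 0.
  by have -> : v - z - F 0 - (u - w - F 0) = w - z - (u - v) by ring.
have [Q QP] := choice main; exists Q.
  near=> tau; have Ttau : T <= tau by near: tau; exact: (nbhs_pinfty_ge (num_real _)).
  by have [] := QP tau Ttau.
apply: cvg_mx_entries => a j; rewrite ord1.
apply: (@cvg_pinfty_le R _ (fun tau => K / tau) _ T) (cvg_pinfty_inv K) => t Tt.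
by have [_] := QP t Tt; apply.
Unshelve. all: by end_near. Qed.

End adiabatic_currents.

(** * The low temperature limit *)

Section low_temperature_boltzmann.
Variables (R : realType) (G : graph).
Hypothesis cG : connected_graph G.
Local Notation n := (nvertices G).
Local Notation m := (nedges G).
Local Notation D := (@boundary R G).
Implicit Types (b : R) (x : params R G) (g h : loop R G).

Lemma velocity_bound h : exists2 M : R, 0 <= M &
  forall i (t : R), t \in `[0, 1] -> `|(derive1n 1 h t).1 0 i| <= M.
Proof.
exact: (@finite_continuous_bounded R _ (fun i t => (derive1n 1 h t).1 0 i)
  (@continuous_velocity R G h)).
Qed.

Lemma velocity_averageE h b (t : R) i :
  (derive1n 1 h t).1 0 i - \sum_j boltzmann b (h t) j 0 * (derive1n 1 h t).1 0 j =
  \sum_j boltzmann b (h t) j 0 *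
    ((derive1n 1 h t).1 0 i - (derive1n 1 h t).1 0 j).
Proof.
under [RHS]eq_bigr do rewrite mulrBr.
by rewrite sumrB -mulr_suml sum_boltzmann// mul1r.
Qed.

Lemma boltzmann_rate_le h b M (t : R) : 0 <= b ->
  (forall i, `|(derive1n 1 h t).1 0 i| <= M) ->
  forall i, `|boltzmann_rate b h t i 0| <= b * (2 * M).
Proof.
move=> b0 hM i; have M0 : 0 <= M by apply: le_trans (hM i).
rewrite mxE velocity_averageE -mulrA mulNr normrN normrM ger0_norm//.
rewrite ler_wpM2l//.
rewrite normrM -[leRHS]mul1r ler_pM//.
  by rewrite ger0_norm ?boltzmann_le1// ltW// boltzmann_gt0.
apply: (le_trans (ler_norm_sum _ _ _)).
rewrite -[leRHS]mul1r -[X in X * _](sum_boltzmann cG b (h t)) mulr_suml.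
apply: ler_sum => j _.
rewrite normrM (ger0_norm (ltW (boltzmann_gt0 cG _ _ _))).
rewrite ler_wpM2l ?(ltW (boltzmann_gt0 cG _ _ _))//.
by rewrite (le_trans (ler_normB _ _))// mulr2n mulrDl mul1r lerD.
Qed.

Lemma boltzmann_excited b (d : R) x i0 : 0 <= b ->
  (forall j, j != i0 -> d <= x.1 0 j - x.1 0 i0) ->
  forall j, j != i0 -> boltzmann b x j 0 <= expR (- (b * d)).
Proof.
move=> b0 gap j ji; rewrite mxE ler_pdivrMr ?partition_function_gt0//.
apply: (@le_trans _ _ (expR (- (b * d)) * expR (- (b * x.1 0 i0)))).
  rewrite -expRD ler_expR; have := ler_wpM2l b0 (gap j ji).
  by rewrite mulrBr; lra.
rewrite ler_wpM2l ?expR_ge0// /partition_function (bigD1 i0)//= lerDl.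
by apply: sumr_ge0 => k _; exact: expR_ge0.
Qed.

Lemma boltzmann_ground b (d : R) x i0 : 0 <= b ->
  (forall j, j != i0 -> d <= x.1 0 j - x.1 0 i0) ->
  forall i, `|(i == i0)%:R - boltzmann b x i 0| <= n%:R * expR (- (b * d)).
Proof.
move=> b0 gap i; have exc := boltzmann_excited b0 gap.
have n1 : 1 <= n%:R :> R by rewrite ler1n; have [] := cG.
have [->|ii0] := eqVneq i i0; last first.
  rewrite sub0r normrN (ger0_norm (ltW (boltzmann_gt0 cG _ _ _))).
  by rewrite (le_trans (exc i ii0))// ler_peMl ?expR_ge0.
have -> : true%:R - boltzmann b x i0 0 = \sum_(j | j != i0) boltzmann b x j 0.
  by rewrite -(sum_boltzmann cG b x) (bigD1 i0)//= addrAC subrr add0r.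
rewrite ger0_norm; last first.
  by apply: sumr_ge0 => j _; exact/ltW/boltzmann_gt0.
rewrite big_mkcond/=; apply: ler_sum_ord => j.
case: ifPn => [/exc//|_]; exact: expR_ge0.
Qed.

(** Up to the factor [- b], the rate is a sum over pairs of states of the product
    of their probabilities and of the difference of their velocities, and every
    pair of distinct states contains an excited one. *)
Lemma boltzmann_rate_ground h b M (d t : R) i0 : 0 <= b ->
  (forall i, `|(derive1n 1 h t).1 0 i| <= M) ->
  (forall j, j != i0 -> d <= (h t).1 0 j - (h t).1 0 i0) ->
  forall i, `|boltzmann_rate b h t i 0| <= 2 * M * n%:R * (b * expR (- (b * d))).
Proof.
move=> b0 hM gap i; have M0 : 0 <= M by apply: le_trans (hM i).
have exc := boltzmann_excited b0 gap.
have n1 : 1 <= n%:R :> R by rewrite ler1n; have [] := cG.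
have dM j : `|(derive1n 1 h t).1 0 i - (derive1n 1 h t).1 0 j| <= 2 * M.
  by rewrite (le_trans (ler_normB _ _))// mulr2n mulrDl mul1r lerD.
have pos j : 0 <= boltzmann b (h t) j 0 by rewrite ltW// boltzmann_gt0.
rewrite mxE velocity_averageE -mulrA mulNr normrN normrM ger0_norm//.
rewrite mulrCA ler_wpM2l// normrM (ger0_norm (pos i)).
have [ii0|ii0] := eqVneq i i0.
  rewrite -[leRHS]mul1r ler_pM ?boltzmann_le1//.
  apply: (le_trans (ler_norm_sum _ _ _)).
  rewrite [2 * M * _]mulrC -mulrA; apply: ler_sum_ord => j.
  rewrite normrM (ger0_norm (pos j)) [leRHS]mulrC.
  have [->|ji0] := eqVneq j i0.
    by rewrite ii0 subrr normr0 mulr0 mulr_ge0 ?expR_ge0// mulr_ge0.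
  by rewrite ler_pM// exc.
rewrite mulrC ler_pM// ?exc//.
apply: (@le_trans _ _ (2 * M)); last by rewrite ler_peMr// mulr_ge0.
apply: (le_trans (ler_norm_sum _ _ _)).
rewrite -[leRHS]mul1r -[X in X * _](sum_boltzmann cG b (h t)) mulr_suml.
apply: ler_sum => j _.
by rewrite normrM (ger0_norm (pos j)) ler_wpM2l.
Qed.

End low_temperature_boltzmann.

Section robustness.
Variables (R : realType) (G : graph).
Hypothesis cG : connected_graph G.
Local Notation n := (nvertices G).
Local Notation m := (nedges G).
Local Notation D := (@boundary R G).
Implicit Types (b : R) (x : params R G) (g h : loop R G).

Definition barrier_order x : rel 'I_m := fun a c => x.2 0 a < x.2 0 c.

(** A choice that depends on [x] only through [barrier_order x]; hence it is
    constant along a path as long as the order of the barriers does not change. *)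
Definition limit_response x : 'M[R]_(m, n) :=
  xget 0 [set L | tree_response D (barrier_order x) L].

Lemma limit_responseP x : injective (fun a => x.2 0 a) ->
  tree_response D (barrier_order x) (limit_response x).
Proof.
move=> injW; have [L LP] := ex_tree_response D injW.
exact: (xgetPex 0 (ex_intro [set L | tree_response D (barrier_order x) L] L LP)).
Qed.

Definition transported h b (s t : R) a : R :=
  primitive (adiabatic_density b h a) t - primitive (adiabatic_density b h a) s.

(** The part of the transported current that depends on the Boltzmann
    distributions at the end points of a time interval. The reference loop [g]
    fixes the trees, so that neighbouring loops [h] use the same ones. *)
Definition endpoint_term g h b (t : R) a : R :=
  (limit_response (g t) *m boltzmann b (h t)) a 0.

(** Up to end point terms, which telescope and cancel along a loop, the current
    transported between [s] and [t] has a low temperature limit that is the same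
    for all loops in a neighbourhood of [g]. *)
Definition settles g (s t : R) : Prop := exists2 e : R, 0 < e &
  exists v : 'I_m -> R, forall h, Ck_ball g 0 e h -> forall a,
    (transported h b s t a - (endpoint_term g h b t a - endpoint_term g h b s a))
      @[b --> +oo] --> v a.

Lemma settles_refl g (t : R) : settles g t t.
Proof.
exists 1 => //; exists (fun=> 0) => h _ a; rewrite /transported.
under eq_fun do rewrite !subrr; exact: cvg_cst.
Qed.

Lemma settles_trans g (s t u : R) :
  settles g s t -> settles g t u -> settles g s u.
Proof.
move=> [e e0 [v vP]] [f f0 [w wP]].
exists (Num.min e f); first by rewrite lt_min e0.
exists (fun a => v a + w a) => h gh a.
have he : Ck_ball g 0 e h by apply: Ck_ball_sub gh; rewrite // ge_min lexx.
have hf : Ck_ball g 0 f h by apply: Ck_ball_sub gh; rewrite // ge_min lexx orbT.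
have -> : (fun b => transported h b s u a -
      (endpoint_term g h b u a - endpoint_term g h b s a)) = (fun b =>
    (transported h b s t a - (endpoint_term g h b t a - endpoint_term g h b s a)) +
    (transported h b t u a - (endpoint_term g h b u a - endpoint_term g h b t a))).
  by apply/funext => b; rewrite /transported; ring.
by apply: cvgD; [exact: vP|exact: wP].
Qed.

Lemma finite_gap (I : finType) (P : pred I) (f : I -> R) :
  (forall i, P i -> 0 < f i) ->
  exists2 d : R, 0 < d & forall i, P i -> d <= f i.
Proof.
move=> f0; exists (\big[Num.min/1]_(i | P i) f i).
  by elim/big_ind: _ => // u v u0 v0; rewrite lt_min u0.
by move=> i Pi; exact: bigmin_le_cond.
Qed.

(** The response is bounded uniformly in the barriers and the Boltzmann
    distribution is almost stationary, so no current flows at low temperature.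
    Only the end point terms remain, and these converge since the distribution
    concentrates on the ground state. *)
Lemma settles_near_ground_state g (t0 : R) :
  injective (fun i => (g t0).1 0 i) ->
  exists2 d : R, 0 < d & forall s t : R, s \in `[0, 1] -> t \in `[0, 1] -> s <= t ->
    `|s - t0| < d -> `|t - t0| < d -> settles g s t.
Proof.
move=> injE; have [n0 _] := cG.
have [i0 _ i0min] := @arg_minP _ _ _ (Ordinal n0) predT (fun i => (g t0).1 0 i) isT.
have [gap gap0 gapP] : exists2 d : R, 0 < d & forall j, j != i0 ->
    d <= (g t0).1 0 j - (g t0).1 0 i0.
  apply: finite_gap => j ji0; rewrite subr_gt0 lt_neqAle (i0min j isT) andbT.
  by apply: contra ji0 => /eqP/injE ->.
have e0 : 0 < gap / 8 by lra.
have [d d0 dP] := uniformly_close g t0 e0.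
exists d => // s t s01 t01 st sd td.
exists (gap / 8) => //; exists (fun a =>
  - (limit_response (g t) a i0 - limit_response (g s) a i0)) => h gh a.
have between u := @close_between R t0 d s t u s01 t01 sd td.
(* A loop within [gap / 8] of [g] moves each energy by at most [gap / 4]. *)
have gap2 u : s <= u <= t -> forall j, j != i0 ->
    gap / 2 <= (h u).1 0 j - (h u).1 0 i0.
  move=> /between[u01 ud] j /gapP; have hu := dP h u gh u01 ud.
  have := le_lt_trans (energy_le_norm (h u - g t0) j) hu.
  have := le_lt_trans (energy_le_norm (h u - g t0) i0) hu.
  rewrite !mxE !ltr_norml => /andP[h1 h2] /andP[h3 h4] h5; lra.
have gap20 : 0 < gap / 2 by lra.
have [M M0 hM] := velocity_bound h.
have transp : transported h b s t a @[b --> +oo] --> 0.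
  pose K := n%:R * (2 * M * n%:R * (4 / (gap / 2) ^+ 2)).
  apply: (@cvg_pinfty_le R _ (fun b => K / b) _ 1) (cvg_pinfty_inv K) => b b1.
  have b0 : 0 < b by lra.
  rewrite sub0r normrN.
  have K0 : 0 <= K / b.
    by rewrite divr_ge0 ?(ltW b0)// !mulr_ge0// invr_ge0 exprn_ge0// ltW.
  apply: (@le_trans _ _ (K / b * (t - s))); last first.
    by rewrite ler_piMr// (unit_itv_length s01 t01).
  have dens (u : R) : is_derive u 1 (primitive (adiabatic_density b h a))
      (adiabatic_density b h a u).
    exact: is_derive_primitive u (@continuous_adiabatic_density R G cG b h a).
  apply: (le_increment st (fun u _ => dens u)) => u; rewrite in_itv/= => ust.
  have [u01 _] := between u ust.
  apply: (le_trans (le_response cG b (h u) a (sum_boltzmann_rate cG b h u))).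
  rewrite /K -mulrA; apply: ler_sum_ord => i.
  have hMu j := hM j u u01.
  apply: (le_trans (boltzmann_rate_ground cG (ltW b0) hMu (gap2 u ust) i)).
  by rewrite -[leRHS]mulrA ler_wpM2l ?mulr_ge0// mul_expRN_le_inv.
have endp u : s <= u <= t ->
    endpoint_term g h b u a @[b --> +oo] --> limit_response (g u) a i0.
  move=> ust; pose K := \sum_i `|limit_response (g u) a i| * (n%:R * (gap / 2)^-1).
  apply: (@cvg_pinfty_le R _ (fun b => K / b) _ 1) (cvg_pinfty_inv K) => b b1.
  have b0 : 0 < b by lra.
  rewrite /endpoint_term mxE.
  have -> : limit_response (g u) a i0 =
      \sum_i limit_response (g u) a i * (i == i0)%:R.
    rewrite (bigD1 i0)//= eqxx mulr1 big1 ?addr0// => i /negbTE ->.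
    by rewrite mulr0.
  rewrite -sumrB /K mulr_suml (le_trans (ler_norm_sum _ _ _))// ler_sum// => i _.
  rewrite -mulrBr normrM -!mulrA ler_wpM2l//.
  apply: (le_trans (boltzmann_ground cG (ltW b0) (gap2 u ust) i)).
  by rewrite ler_wpM2l// expRN_le_inv.
rewrite -[X in _ --> X]add0r; apply: cvgD => //; apply: cvgN.
by apply: cvgB; apply: endp; rewrite lexx st.
Qed.

(** The order of the barriers does not change, so that the current is the flow
    along a fixed tree that moves the Boltzmann distribution: it is a
    difference of end point terms up to an error of order
    [b * expR (- b * gap / 2)]. *)
Lemma settles_near_distinct_barriers g (t0 : R) :
  injective (fun a => (g t0).2 0 a) ->
  exists2 d : R, 0 < d & forall s t : R, s \in `[0, 1] -> t \in `[0, 1] -> s <= t ->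
    `|s - t0| < d -> `|t - t0| < d -> settles g s t.
Proof.
move=> injW.
have [gap gap0 gapP] : exists2 d : R, 0 < d & forall ac : 'I_m * 'I_m,
    (g t0).2 0 ac.1 < (g t0).2 0 ac.2 -> d <= (g t0).2 0 ac.2 - (g t0).2 0 ac.1.
  by apply: finite_gap => ac lt_ac; rewrite subr_gt0.
have e0 : 0 < gap / 8 by lra.
have [d d0 dP] := uniformly_close g t0 e0.
exists d => // s t s01 t01 st sd td.
exists (gap / 8) => //; exists (fun=> 0) => h gh a.
have between u := @close_between R t0 d s t u s01 t01 sd td.
have gap2 (k : loop R G) u : Ck_ball g 0 (gap / 8) k -> s <= u <= t ->
    forall c c', barrier_order (g t0) c c' -> gap / 2 <= (k u).2 0 c' - (k u).2 0 c.
  move=> gk /between[u01 ud] c c' /(gapP (c, c'))/=; have ku := dP k u gk u01 ud.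
  have := le_lt_trans (barrier_le_norm (k u - g t0) c') ku.
  have := le_lt_trans (barrier_le_norm (k u - g t0) c) ku.
  rewrite !mxE !ltr_norml => /andP[h1 h2] /andP[h3 h4] h5; lra.
have gap20 : 0 < gap / 2 by lra.
(* Applied to [g] itself, [gap2] also shows that the order is constant. *)
have same_order u : s <= u <= t -> barrier_order (g u) = barrier_order (g t0).
  move=> ust; apply/funext => c; apply/funext => c'.
  have lt_gu k k' : barrier_order (g t0) k k' -> barrier_order (g u) k k'.
    move=> /(gap2 g u (@Ck_ball_center R G g 0 _ e0) ust) h1.
    by rewrite /barrier_order -subr_gt0; lra.
  apply/idP/idP => [|]; last exact: lt_gu.
  move=> lt_u; rewrite /barrier_order ltNge le_eqVlt.
  apply/negP => /orP[/eqP/injW e|/lt_gu].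
    by move: lt_u; rewrite /barrier_order e ltxx.
  by move: lt_u; rewrite /barrier_order => /ltW; rewrite leNgt => /negP.
pose L := limit_response (g t0).
have LE u : s <= u <= t -> limit_response (g u) = L.
  by move=> ust; rewrite /L /limit_response same_order.
have [K K0 KP] := limit_responseP injW.
have [M M0 hM] := velocity_bound h.
pose N := n%:R * (2 * M).
have N0 : 0 <= N by rewrite mulr_ge0// mulr_ge0.
pose C := K * (4 / (gap / 2) ^+ 2) * N.
apply: (@cvg_pinfty_le R _ (fun b => C / b) _ 1) (cvg_pinfty_inv C) => b b1.
have b0 : 0 < b by lra.
rewrite sub0r normrN /endpoint_term !LE ?lexx ?st//.
(* The increment of [F] is the quantity to be estimated. *)
pose F u := primitive (adiabatic_density b h a) u -
  \sum_i L a i * boltzmann b (h u) i 0.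
pose F' u := adiabatic_density b h a u - \sum_i L a i * boltzmann_rate b h u i 0.
have Fd (u : R) : is_derive u 1 F (F' u).
  have d1 := is_derive_primitive u (@continuous_adiabatic_density R G cG b h a).
  apply: is_deriveB; apply: is_derive_bigsum => i _.
  exact: is_deriveZ (is_derive_boltzmann cG b h u i).
have -> : transported h b s t a - ((L *m boltzmann b (h t)) a 0 -
    (L *m boltzmann b (h s)) a 0) = F t - F s.
  by rewrite /transported /F !mxE; ring.
have C0 : 0 <= C / b.
  by rewrite divr_ge0 ?(ltW b0)// !mulr_ge0// invr_ge0 exprn_ge0// ltW.
apply: (@le_trans _ _ (C / b * (t - s))); last first.
  by rewrite ler_piMr// (unit_itv_length s01 t01).
apply: (le_increment st (fun u _ => Fd u)) => u; rewrite in_itv/= => ust.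
have [u01 _] := between u ust.
pose p := boltzmann_rate b h u.
have p0 : \sum_i p i 0 = 0 by exact: sum_boltzmann_rate.
pose c := response b (h u) *m p.
have cN a' : `|c a' 0| <= b * N.
  apply: (le_trans (le_response cG b (h u) a' p0)).
  rewrite /N mulrCA; apply: ler_sum_ord => i.
  exact: (boltzmann_rate_le cG (ltW b0) (fun j => hM j u u01)).
have wlt c1 c2 : barrier_order (g t0) c1 c2 ->
    expR (b * (h u).2 0 c1) <= expR (- (b * (gap / 2))) * expR (b * (h u).2 0 c2).
  move=> c12; rewrite -expRD ler_expR.
  have := ler_wpM2l (ltW b0) (gap2 h u gh ust c1 c2 c12).
  by rewrite mulrBr; lra.
have orth (z : C1 R G) : D *m z = 0 ->
    \sum_a expR (b * (h u).2 0 a) * c a 0 * z a 0 = 0.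
  exact: response_cycle.
have h1 := KP (fun a' => expR (b * (h u).2 0 a')) _ _ c
  (fun a' => expR_gt0 _) (expR_ge0 _) wlt cN orth a.
have -> : F' u = c a 0 + (L *m (D *m c)) a 0.
  rewrite /F' /adiabatic_density -/p -/c; congr (_ + _).
  by rewrite boundary_response// mulmxN [RHS]mxE [in RHS]mxE.
apply: (le_trans h1).
have := ler_wpM2l (mulr_ge0 K0 N0) (mul_expRN_le_inv gap20 b0).
have -> : K * N * (b * expR (- (b * (gap / 2)))) =
  K * expR (- (b * (gap / 2))) * (b * N) by ring.
by move=> /le_trans; apply; rewrite le_eqVlt /C; apply/orP; left; apply/eqP; ring.
Qed.

Lemma generic_loop_settles g : generic_loop g -> settles g 0 1.
Proof.
move=> gg; apply: interval_induction; [exact: settles_refl|exact: settles_trans|].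
move=> t0 /gg[]; first exact: settles_near_ground_state.
exact: settles_near_distinct_barriers.
Qed.

(** Along the whole loop the end point terms cancel by periodicity. *)
Lemma generic_loop_robust g : generic_loop g -> intrinsically_robust g.
Proof.
move=> /generic_loop_settles[e e0 [v vP]].
have nb : nbhs g (Ck_ball g 0 e) by exists 0%N, e.
exists (Ck_ball g 0 e)^°; first by split; [exact: open_interior|exact: nb].
exists (\col_a v a) => h /interior_subset gh.
exists (fun b => adiabatic_current b h); first by move=> b _; exact: adiabatic_limit.
apply: cvg_mx_entries => a j; rewrite ord1 mxE.
have -> : (fun b => adiabatic_current b h a 0) = (fun b => transported h b 0 1 a -
    (endpoint_term g h b 1 a - endpoint_term g h b 0 a)).
  apply/funext => b; rewrite mxE /endpoint_term !loop_one_zero subrr subr0.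
  by [].
exact: vP.
Qed.

Lemma intrinsically_robust_open : open (@intrinsically_robust R G).
Proof.
rewrite openE => g [U [oU Ug] [q Uq]]; apply: (filterS _ (open_nbhs_nbhs (conj oU Ug))).
by move=> h Uh; exists U => //; exists q.
Qed.

End robustness.

Theorem corollary4 (R : realType) (G : graph) (hG : connected_graph G) :
  [/\ open (@intrinsically_robust R G),
      dense (@intrinsically_robust R G)
    & forall (g : loop R G) (k : nat) (e : R), 0 < e ->
        exists2 g1 : loop R G, intrinsically_robust g1 & Ck_ball g k e g1].
Proof.
have approx (g : loop R G) (k : nat) (e : R) : 0 < e ->
    exists2 g1 : loop R G, intrinsically_robust g1 & Ck_ball g k e g1.
  move=> e0; have [g1 gg1 g1e] := generic_perturbation g k e0.
  by exists g1 => //; exact: generic_loop_robust.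
split=> //; first exact: intrinsically_robust_open.
move=> O [g Og] oO; have [k [e e0 eO]] : nbhs g O by exact: open_nbhs_nbhs.
by have [g1 rg1 /eO Og1] := approx g k e e0; exists g1.
Qed.
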